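(* Let $\alpha\neq0$ and $\lambda\in\mathbb{R}$, and let $g_t$, $t\in I$, solve the evolution equation $g''=\Gamma^-_g(g',g')-2\alpha\operatorname{grad}^-S_\lambda(g)$ with $\delta^{-}_{g_{t_0}}g'_{t_0}=0$ and $\mathcal{H}_\lambda(g_{t_0},g'_{t_0})=0$ for some $t_0\in I$. Then both constraints $\delta^-_{g_t}g_t'=0$ and $\mathcal{H}_\lambda(g_t,g_t')=0$ hold for all $t\in I$; hence the metric $\widetilde g=\alpha\,dt^2+g_t$ on $I\times M$ is Einstein with constant $\lambda$, that is, $\rho(\widetilde g)=\lambda\widetilde g$, on all of $I\times M$.
   Context: $M$ is a compact connected smooth manifold without boundary, $\dim M=n\ge2$. $S^2(M)$ is the Fréchet space of smooth symmetric $(0,2)$-tensor fields on $M$, and $\mathcal{M}\subset S^2(M)$ is the open cone of Riemannian metrics. A solution $g_t$, $t\in I$ ($I$ an open interval), is a smooth curve in $\mathcal{M}$; primes denote $t$-derivatives. The pseudo-Riemannian metric $\widetilde g=\alpha\,dt^2+g_t$ on $I\times M$ restricts to $g_t$ on $\{t\}\times M$, makes $\partial_t$ orthogonal to $TM$, and has $\widetilde g(\partial_t,\partial_t)=\alpha$. For $g\in\mathcal{M}$: $\rho(g)$ is the Ricci tensor, $\tau(g)=\operatorname{tr}_g\rho(g)$ the scalar curvature, $\mu_g$ the volume density, $\operatorname{tr}_gh=\operatorname{tr}(g^{-1}h)$, $(\delta_gh)_j=-g^{ik}\nabla_ih_{kj}$, and $$\langle h,k\rangle^-_g=\operatorname{tr}(g^{-1}hg^{-1}k)-\operatorname{tr}_g(h)\operatorname{tr}_g(k),\qquad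 G^-_g(h,k)=\int_M\langle h,k\rangle^-_g\,\mu_g,\qquad \delta^-_gh=\delta_gh+d(\operatorname{tr}_gh).$$ $\Gamma^-_g(h,h)=hg^{-1}h-\tfrac12\operatorname{tr}_g(h)h-\tfrac{1}{4(n-1)}\langle h,h\rangle^-_g\,g$ is the Christoffel map of $G^-$. Further, $\tau_\lambda(g)=\tau(g)-\lambda(n-1)$, $S_\lambda(g)=\int_M\tau_\lambda(g)\mu_g$, with $G^-$-gradient $\operatorname{grad}^-S_\lambda(g)=-\rho(g)+\frac{1}{2(n-1)}\tau(g)g+\frac{\lambda}{2}g$, and $\mathcal{H}_\lambda(g,k)=\tfrac12\langle k,k\rangle^-_g+2\alpha\tau_\lambda(g)\in C^\infty(M)$. *)

(* Defs.v *)
From mathcomp Require Import all_boot all_order all_algebra.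
From mathcomp Require Import all_classical all_reals all_analysis.

Set Implicit Arguments.
Unset Strict Implicit.
Unset Printing Implicit Defensive.

Import Order.TTheory GRing.Theory Num.Theory.
Import numFieldNormedType.Exports.

Local Open Scope classical_set_scope.
Local Open Scope ring_scope.

(* Points of R^n are row vectors; functions on an open subset of R^n are total
   functions whose values outside of the subset are irrelevant. *)
Section Coordinates.
Context {R : realType} {n : nat}.
Implicit Types (f : 'rV[R]_n -> R) (V : set 'rV[R]_n).

Definition partial (i : 'I_n) f (x : 'rV[R]_n) : R := 'D_(delta_mx 0 i) f x.

Definition partials (s : seq 'I_n) f : 'rV[R]_n -> R := foldr partial f s.

Definition smooth_on V f : Prop :=
  forall (s : seq 'I_n) x, V x ->
    {for x, continuous (partials s f)} /\
    forall i, derivable (partials s f) x (delta_mx 0 i).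

End Coordinates.

(* In the next section [g] is the matrix of components g_ij of a (pseudo-)
   Riemannian metric in a coordinate chart, and [h], [k] are matrices of
   components of symmetric (0,2)-tensor fields in the same chart. *)
Section LocalTensorCalculus.
Context {R : realType} {n : nat}.
Implicit Types (g h k : 'rV[R]_n -> 'M[R]_n) (x : 'rV[R]_n) (lambda alpha : R).

(* Gamma^a_ij *)
Definition christoffel g (a i j : 'I_n) x : R :=
  2^-1 * \sum_(l < n) invmx (g x) a l *
    (partial i (fun y => g y j l) x + partial j (fun y => g y i l) x
     - partial l (fun y => g y i j) x).

(* Sign convention: the Ricci tensor of a round sphere is positive. *)
Definition ricci g x : 'M[R]_n := \matrix_(i, j)
  (\sum_(a < n) (partial a (christoffel g a i j) x
                 - partial j (christoffel g a i a) x)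
   + \sum_(a < n) \sum_(b < n)
       (christoffel g a a b x * christoffel g b i j x
        - christoffel g a j b x * christoffel g b i a x)).

Definition trg g h x : R := \tr (invmx (g x) *m h x).

Definition scal g x : R := trg g (ricci g) x.

(* nabla_i h_aj *)
Definition nabla g h (i a j : 'I_n) x : R :=
  partial i (fun y => h y a j) x
  - \sum_(l < n) (christoffel g l i a x * h x l j
                  + christoffel g l i j x * h x a l).

Definition div g h x : 'rV[R]_n := \row_j
  (- \sum_(i < n) \sum_(a < n) invmx (g x) i a * nabla g h i a j x).

Definition divm g h x : 'rV[R]_n :=
  div g h x + \row_j partial j (trg g h) x.

Definition dotm g h k x : R :=
  \tr (invmx (g x) *m h x *m invmx (g x) *m k x) - trg g h x * trg g k x.

(* The quadratic map h |-> Gamma^-_g(h, h). *)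
Definition christoffelm g h x : 'M[R]_n :=
  h x *m invmx (g x) *m h x - (2^-1 * trg g h x) *: h x
  - ((4 * (n%:R - 1))^-1 * dotm g h h x) *: g x.

Definition scal_shift lambda g x : R := scal g x - lambda * (n%:R - 1).

Definition gradm lambda g x : 'M[R]_n :=
  - ricci g x + ((2 * (n%:R - 1))^-1 * scal g x) *: g x + (lambda / 2) *: g x.

Definition hamiltonian alpha lambda g k x : R :=
  2^-1 * dotm g k k x + 2 * alpha * scal_shift lambda g x.

End LocalTensorCalculus.

(* A space with a family of R^n-valued charts; [chart_map c] is meaningful only
   on [chart_dom c]. *)
Record chartedSpace (R : realType) (n : nat) := ChartedSpace {
  space :> topologicalType;
  chart : Type;
  chart_dom : chart -> set space;
  chart_map : chart -> space -> 'rV[R]_n }.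

Arguments chart_dom {R n _} _.
Arguments chart_map {R n _} _ _.

Section Manifolds.
Context {R : realType} {n : nat}.
Implicit Types (M : chartedSpace R n).

Definition chart_image M (c : chart M) : set 'rV[R]_n :=
  chart_map c @` chart_dom c.

(* chart_map d \o (chart_map c)^-1, with value 0 outside of
   chart_map c @` (chart_dom c `&` chart_dom d) *)
Definition transition M (c d : chart M) (x : 'rV[R]_n) : 'rV[R]_n :=
  xget 0 [set y | exists p, [/\ chart_dom c p, chart_dom d p,
                                chart_map c p = x & chart_map d p = y]].

Definition smooth_manifold M : Prop :=
  [/\ hausdorff_space M,
      second_countable (T := M),
      (forall p : M, exists c : chart M, chart_dom c p),
      (forall c : chart M,
        [/\ open (chart_dom c),
            set_inj (chart_dom c) (chart_map c),
            (forall p, chart_dom c p -> {for p, continuous (chart_map c)}) &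
            (forall U : set M, open U -> U `<=` chart_dom c ->
               open (chart_map c @` U))]) &
      (forall (c d : chart M) (j : 'I_n),
        smooth_on (chart_map c @` (chart_dom c `&` chart_dom d))
          (fun x => transition c d x 0 j))].

(* A (0,2)-tensor field is given by its matrix of components in each chart, as a
   function of the coordinates; only the values on chart_image c matter. *)
Definition tfield M := chart M -> 'rV[R]_n -> 'M[R]_n.

(* Row i of [jacobian c d x] is the i-th partial derivative of the transition
   map from the coordinates of c to those of d. *)
Definition jacobian_mx M (c d : chart M) (x : 'rV[R]_n) : 'M[R]_n :=
  \matrix_(i, a) partial i (fun y => transition c d y 0 a) x.

(* S^2(M) *)
Definition sym2_field M (h : tfield M) : Prop :=
  [/\ (forall c (i j : 'I_n), smooth_on (chart_image c) (fun x => h c x i j)),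
      (forall c x, chart_image c x -> (h c x)^T = h c x) &
      (forall (c d : chart M) p, chart_dom c p -> chart_dom d p ->
         let J := jacobian_mx c d (chart_map c p) in
         h c (chart_map c p) = J *m h d (chart_map d p) *m J^T)].

Definition riemannian M (g : tfield M) : Prop :=
  sym2_field g /\
  forall c x, chart_image c x ->
    forall v : 'rV[R]_n, v != 0 -> 0 < (v *m g c x *m v^T) 0 0.

(* [k] is the derivative at t of the curve [h] in the Frechet space S^2(M), whose
   topology is given by the seminorms sup_K |partials s h_ij| with K a compact
   subset of the image of a chart. *)
Definition frechet_deriv M (h : R -> tfield M) (t : R) (k : tfield M) : Prop :=
  forall (c : chart M) (K : set 'rV[R]_n) (s : seq 'I_n) (i j : 'I_n),
    compact K -> K `<=` chart_image c ->
    forall eps : R, 0 < eps ->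
    \forall e \near 0^', forall x, K x ->
      `| partials s (fun y =>
           e^-1 * (h (t + e) c y i j - h t c y i j) - k c y i j) x | < eps.

(* [H m] is the m-th derivative of the curve [h] on the open set [I]. *)
Definition smooth_curve M (I : set R) (h : R -> tfield M) : Prop :=
  exists H : nat -> R -> tfield M, H 0%N = h /\
    forall m t, I t -> sym2_field (H m t) /\ frechet_deriv (H m) t (H m.+1 t).

Definition dt M (h : R -> tfield M) : R -> tfield M :=
  fun t c x => derive1 (fun s => h s c x) t.

Definition einstein M (g : tfield M) (lambda : R) : Prop :=
  forall c x, chart_image c x -> ricci (g c) x = lambda *: g c x.

End Manifolds.

Section Cylinder.
Context {R : realType} {n : nat}.
Implicit Types (M : chartedSpace R n) (I : set R).

(* I x M with the product charts (t, p) |-> (t, chart_map c p) *)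
Definition cylinder I M : chartedSpace R (1 + n) :=
  @ChartedSpace R (1 + n) (I * M)%type (chart M)
    (fun c q => chart_dom c q.2)
    (fun c q => row_mx (const_mx (set_val q.1)) (chart_map c q.2)).

(* alpha dt^2 + g_t *)
Definition cylinder_metric I M (alpha : R) (g : R -> tfield M) :
    tfield (cylinder I M) :=
  fun c y => block_mx alpha%:M 0 0 (g (lsubmx y 0 0) c (rsubmx y)).

End Cylinder.

(* Main.v *)
(** In a chart, put h = g', K = g^-1 h and theta = tr K, and let D and E be the
    momentum density delta^- g' and the energy density H_lambda.  The evolution
    equation gives K' = - (theta / 2) K + f Id + 2 alpha Ric^# with an explicit
    function f.  By the contracted Bianchi identity all spatial derivatives
    cancel in D' = - (theta / 2) D (the Noether conservation law of the
    diffeomorphism-invariant Lagrangian).  The variation of the scalar curvature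
    is - <Ric, h> plus the divergence of - g^-1 D, so that once D = 0 also
    E' = - (theta / 2) E.  As (det g)' = theta det g, the functions D_j^2 det g
    and E^2 det g are constant in t at each point of M, hence vanish.  The Ricci
    tensor of alpha dt^2 + g_t has components - D_j / 2,
    - theta' / 2 - tr K^2 / 4 and
    Ric - (h' - h K + theta h / 2) / (2 alpha), which reduce to lambda times the
    metric.

    All these identities are algebraic: they hold in any commutative ring with
    commuting derivations, and are applied to the smooth functions on
    I x (image of a chart). *)

From HB Require Import structures.
Require Import Defs.
From mathcomp Require Import all_boot all_order all_algebra all_fingroup.
From mathcomp Require Import all_classical all_reals all_analysis.
From mathcomp Require Import ring lra.

Set Implicit Arguments.
Unset Strict Implicit.
Unset Printing Implicit Defensive.

Import Order.TTheory GRing.Theory Num.Theory.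
Import numFieldNormedType.Exports.

Local Open Scope classical_set_scope.
Local Open Scope ring_scope.

(** The algebra never divides: 1/2, the inverse metric and 1/(4(n-1)) are ring elements known only
    through [half + half = 1], [g *m gi = 1%:M] and [nu * (n%:R - 1) = half * half], so that
    identities end in [ring] once the index sums are arranged. The same calculus serves twice: for
    the n spatial derivations, with d/dt as an additional derivation [del], and for all 1 + n
    derivations of the cylinder. The obstacle is the passage from analysis to this algebra. A smooth
    curve in the Frechet space is given through difference quotients in t that converge, together
    with their spatial partial derivatives, on compact sets; smoothness jointly in (t, x) is not
    part of the data. The function class is therefore defined by coordinate derivatives alone, and
    is shown to be stable under sums, products and inverses, which is enough to contain the inverse
    metric and the curvature. *)

Definition derivation (A : comNzRingType) (D : A -> A) : Prop :=
  (forall a b, D (a + b) = D a + D b) /\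
  (forall a b, D (a * b) = D a * b + a * D b).

(** * Derivations applied to matrices, traces and determinants *)

Section Derivations.
Variables (A : comNzRingType) (D : A -> A).
Hypothesis dD : derivation D.

Lemma derD a b : D (a + b) = D a + D b. Proof. by case: dD. Qed.

Lemma derM a b : D (a * b) = D a * b + a * D b. Proof. by case: dD. Qed.

Lemma der0 : D 0 = 0.
Proof. by apply: (addIr (D 0)); rewrite -derD !add0r. Qed.

Lemma der1 : D 1 = 0.
Proof.
by apply: (addIr (D 1)); rewrite add0r -{3}(mulr1 1) derM mulr1 mul1r.
Qed.

Lemma derN a : D (- a) = - D a.
Proof. by apply: (addIr (D a)); rewrite -derD !addNr der0. Qed.

Lemma derB a b : D (a - b) = D a - D b.
Proof. by rewrite derD derN. Qed.

Lemma der_nat m : D m%:R = 0.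
Proof. by elim: m => [|m IHm]; rewrite ?der0 // -natr1 derD der1 IHm addr0. Qed.

Lemma der_sum (I : Type) (r : seq I) (P : pred I) (F : I -> A) :
  D (\sum_(i <- r | P i) F i) = \sum_(i <- r | P i) D (F i).
Proof.
elim/big_rec2: _ => [|i x y _ <-]; first exact: der0.
exact: derD.
Qed.

Lemma der_half (h : A) : h + h = 1 -> D h = 0.
Proof.
move=> h2; have Dh2 : D h + D h = 0 by rewrite -derD h2 der1.
by rewrite -[D h]mulr1 -h2 mulrDr -mulrDl Dh2 mul0r.
Qed.

Lemma map_derM m n p (M : 'M[A]_(m, n)) (N : 'M[A]_(n, p)) :
  map_mx D (M *m N) = map_mx D M *m N + M *m map_mx D N.
Proof.
apply/matrixP=> i j; rewrite !mxE der_sum -big_split.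
by apply: eq_bigr => k _; rewrite derM !mxE.
Qed.

Lemma map_derD m n (M N : 'M[A]_(m, n)) :
  map_mx D (M + N) = map_mx D M + map_mx D N.
Proof. by apply/matrixP=> i j; rewrite !mxE derD. Qed.

Lemma map_derN m n (M : 'M[A]_(m, n)) : map_mx D (- M) = - map_mx D M.
Proof. by apply/matrixP=> i j; rewrite !mxE derN. Qed.

Lemma der_tr n (M : 'M[A]_n) : D (\tr M) = \tr (map_mx D M).
Proof. by rewrite /mxtrace der_sum; apply: eq_bigr => i _; rewrite mxE. Qed.

Lemma map_der1 n : map_mx D (1%:M : 'M[A]_n) = 0.
Proof. by apply/matrixP=> i j; rewrite !mxE der_nat. Qed.

Lemma map_der_inv n (g gi : 'M[A]_n) : g *m gi = 1%:M ->
  map_mx D gi = - (gi *m map_mx D g *m gi).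
Proof.
move=> ggi; have gig := mulmx1C ggi.
have := map_der1 n; rewrite -ggi map_derM => /eqP.
rewrite addrC addr_eq0 => /eqP eq1.
by rewrite -[LHS]mul1mx -gig -(mulmxA gi g) eq1 mulmxN !mulmxA.
Qed.

Lemma der_prod (I : finType) (F : I -> A) :
  D (\prod_i F i) = \sum_i D (F i) * \prod_(j | i != j) F j.
Proof.
suff gen (r : seq I) : uniq r -> D (\prod_(i <- r) F i) =
    \sum_(i <- r) D (F i) * \prod_(j <- r | i != j) F j.
  by apply: gen; rewrite index_enum_uniq.
elim: r => [|i r IHr] /=; first by rewrite !big_nil der1.
case/andP=> inr ur; rewrite !big_cons derM IHr // eqxx /=.
congr (_ * _ + _).
  rewrite [LHS]big_seq [RHS]big_seq_cond; apply: eq_bigl => j.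
  by case jr: (j \in r) => //=; apply/esym; apply: contraNneq inr => ->.
rewrite mulr_sumr !big_seq; apply: eq_bigr => j jr.
rewrite big_cons (_ : j != i); first by rewrite mulrCA.
by apply: contraNneq inr => <-.
Qed.

(** Jacobi's formula. Each product of the Leibniz expansion is differentiated, and for fixed i the
    permutations are sorted by j = s i; those sharing i and j add up to the cofactor of (i, j). *)
Lemma der_det n (M : 'M[A]_n) : D (\det M) = \tr (\adj M *m map_mx D M).
Proof.
rewrite /determinant der_sum.
transitivity (\sum_(s : 'S_n) \sum_i D (M i (s i)) *
    ((-1) ^+ s * \prod_(j | i != j) M j (s j))).
  apply: eq_bigr => s _; rewrite derM der_prod mulr_sumr.
  rewrite (_ : D _ = 0); last first.
    by case: odd_perm; rewrite ?expr0 ?expr1 ?derN der1 ?oppr0.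
  by rewrite mul0r add0r; apply: eq_bigr => i _; rewrite mulrCA.
rewrite exchange_big mxtrace_mulC /mxtrace; apply: eq_bigr => i _ /=.
rewrite mxE (partition_big (fun s : 'S_n => s i) xpredT) //=.
apply: eq_bigr => j _; rewrite !mxE expand_cofactor mulr_sumr.
by apply: eq_bigr => s /eqP <-.
Qed.

End Derivations.

(** * Tensor calculus over a ring with commuting derivations *)

Section Metric.
Variables (A : comNzRingType) (n : nat) (d : 'I_n -> A -> A) (half : A).
Variables (g gi : 'M[A]_n).
Hypothesis dD : forall i, derivation (d i).
Hypothesis dC : forall i j a, d i (d j a) = d j (d i a).
Hypothesis half2 : half + half = 1.
Hypothesis gT : g^T = g.
Hypothesis ggi : g *m gi = 1%:M.

Local Notation dm i := (map_mx (d i)).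

Lemma mulmx_inv : gi *m g = 1%:M. Proof. exact: mulmx1C. Qed.

Lemma tr_inv : gi^T = gi.
Proof.
by rewrite -[LHS]mul1mx -mulmx_inv -mulmxA -{1}gT -trmx_mul mulmx_inv trmx1 mulmx1.
Qed.

Lemma entry_sym (M : 'M[A]_n) i j : M^T = M -> M i j = M j i.
Proof. by move=> MT; rewrite -[in LHS]MT mxE. Qed.

(** The connection is kept as n matrices, one per direction i, with entries Gamma_{l,ib} of the
    first kind here. Curvature then has the form dA + A /\ A, and most index sums become matrix
    products. *)
Definition lowerGamma (i : 'I_n) : 'M[A]_n :=
  \matrix_(l, b) (half * (d i (g b l) + d b (g i l) - d l (g i b))).

(* [Gamma i a b] is the Christoffel symbol Gamma^a_ib. *)
Definition Gamma i : 'M[A]_n := gi *m lowerGamma i.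

Lemma GammaE i a b : Gamma i a b =
  half * \sum_l gi a l * (d i (g b l) + d b (g i l) - d l (g i b)).
Proof. by rewrite !mxE mulr_sumr; apply: eq_bigr => l _; rewrite !mxE mulrCA. Qed.

Lemma GammaC i a b : Gamma i a b = Gamma b a i.
Proof.
rewrite !mxE; apply: eq_bigr => l _; rewrite !mxE (@entry_sym g b i) //.
by rewrite (addrC (d i _)).
Qed.

Lemma mul_lowerGamma i : g *m Gamma i = lowerGamma i.
Proof. by rewrite mulmxA ggi mul1mx. Qed.

(** Metric compatibility, nabla g = 0; [der_inv] is the same for the inverse metric. *)
Lemma lowerGamma_sym i : lowerGamma i + (lowerGamma i)^T = dm i g.
Proof.
apply/matrixP=> a b; rewrite !mxE.
rewrite (@entry_sym g b a) // -mulrDr -[RHS]mul1r -half2; ring.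
Qed.

Lemma der_inv i : dm i gi = - (Gamma i *m gi + gi *m (Gamma i)^T).
Proof.
rewrite (map_der_inv (dD i) ggi) -lowerGamma_sym mulmxDr mulmxDl.
by rewrite /Gamma trmx_mul tr_inv !mulmxA.
Qed.

(** The hypothesis says that X is self-adjoint for g. Only the symmetric part of [lowerGamma i] then
    contributes to the trace, and that part is half of d_i g. *)
Lemma tr_Gamma i (X : 'M[A]_n) : (X *m gi)^T = X *m gi ->
  \tr (Gamma i *m X) = half * \tr (gi *m dm i g *m X).
Proof.
move=> XT.
have flip (M : 'M[A]_n) : \tr (gi *m M *m X) = \tr (M *m (X *m gi)).
  by rewrite mxtrace_mulC (mulmxA X) mxtrace_mulC.
rewrite /Gamma !flip -lowerGamma_sym mulmxDl mxtraceD.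
rewrite -(mxtrace_tr ((lowerGamma i)^T *m _)) trmx_mul trmxK XT.
by rewrite (mxtrace_mulC (X *m gi)) mulrDr -mulrDl half2 mul1r.
Qed.

Lemma tr_Gamma1 i : \tr (Gamma i) = half * \tr (gi *m dm i g).
Proof. by have := @tr_Gamma i 1%:M; rewrite !mulmx1 mul1mx; apply; exact: tr_inv. Qed.

(** The trace of g^-1 D g is D (log det g), so this is the commutation of D1 and D2 on log det g,
    stated without a logarithm. *)
Lemma tr_logder_comm (D1 D2 : A -> A) : derivation D1 -> derivation D2 ->
  (forall a, D1 (D2 a) = D2 (D1 a)) ->
  D1 (\tr (gi *m map_mx D2 g)) = D2 (\tr (gi *m map_mx D1 g)).
Proof.
move=> dD1 dD2 D12; rewrite (der_tr dD1) (der_tr dD2) (map_derM dD1) (map_derM dD2).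
rewrite (map_der_inv dD1 ggi) (map_der_inv dD2 ggi) !mulNmx !raddfD /= !raddfN /=.
congr (- _ + _); first by rewrite -(mulmxA (gi *m _)) mxtrace_mulC mulmxA.
by congr (\tr (_ *m _)); apply/matrixP => a b; rewrite !mxE.
Qed.

Lemma tr_Gamma_closed i j : d i (\tr (Gamma j)) = d j (\tr (Gamma i)).
Proof.
rewrite !tr_Gamma1 !(derM (dD _)) !(der_half (dD _) half2) !mul0r !add0r.
by congr (_ * _); exact: tr_logder_comm.
Qed.

(* [curv i j a b] is R^a_bij. *)
Definition curv i j : 'M[A]_n :=
  dm i (Gamma j) - dm j (Gamma i) + Gamma i *m Gamma j - Gamma j *m Gamma i.

Definition Ric : 'M[A]_n := \matrix_(i, j) \sum_a curv a j a i.

Definition Scal : A := \tr (gi *m Ric).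

Lemma addmxE m p (M N : 'M[A]_(m, p)) i j : (M + N) i j = M i j + N i j.
Proof. by rewrite mxE. Qed.

Lemma oppmxE m p (M : 'M[A]_(m, p)) i j : (- M) i j = - M i j.
Proof. by rewrite mxE. Qed.

Lemma curvC i j : curv i j = - curv j i.
Proof. by apply/matrixP => a b; rewrite !(addmxE, oppmxE); ring. Qed.

Lemma RicE i j : Ric i j =
  \sum_a (d a (Gamma j a i) - d j (Gamma a a i)) +
  \sum_a \sum_b (Gamma a a b * Gamma j b i - Gamma j a b * Gamma a b i).
Proof.
rewrite mxE -big_split; apply: eq_bigr => a _ /=.
rewrite !(addmxE, oppmxE) -addrA; congr (_ + _); first by rewrite !mxE.
by rewrite !mxE -sumrB.
Qed.

(** The term d_j Gamma^a_ai is the only one whose symmetry is not a relabelling of indices: it is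
    the derivative of the closed one-form tr Gamma. *)
Lemma Ric_sym : Ric^T = Ric.
Proof.
apply/matrixP => i j; rewrite mxE !RicE; congr (_ + _).
  rewrite !sumrB -!(der_sum (dD _)) -!/(\tr _).
  have tE k : \sum_i0 Gamma i0 i0 k = \tr (Gamma k).
    by apply: eq_bigr => a _; rewrite GammaC.
  rewrite !tE tr_Gamma_closed; congr (_ - _).
  by apply: eq_bigr => a _; rewrite GammaC.
under eq_bigr do rewrite sumrB; under [RHS]eq_bigr do rewrite sumrB.
rewrite !sumrB; congr (_ - _).
  by apply: eq_bigr => a _; apply: eq_bigr => b _; rewrite (GammaC i b).
rewrite exchange_big; apply: eq_bigr => a _; apply: eq_bigr => b _.
by rewrite mulrC (GammaC j) (GammaC _ _ i).
Qed.

(* Covariant derivatives of R^a_b.. and R^ab.. in the upper and lower matrix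
   indices only: since Gamma is symmetric, the terms in the remaining two
   indices cancel in the cyclic sum of the second Bianchi identity. *)
Definition covE i (M : 'M[A]_n) := dm i M + Gamma i *m M - M *m Gamma i.
Definition covB i (M : 'M[A]_n) := dm i M + Gamma i *m M + M *m (Gamma i)^T.

Lemma covBM i (M : 'M[A]_n) : covB i (M *m gi) = covE i M *m gi.
Proof.
rewrite /covB (map_derM (dD i)) der_inv mulmxN mulmxDr !mulmxBl mulmxDl !mulmxA.
by apply/matrixP => a b; rewrite !(addmxE, oppmxE); ring.
Qed.

(** * The second Bianchi identity and its contraction *)

Lemma dmC i j (M : 'M[A]_n) : dm i (dm j M) = dm j (dm i M).
Proof. by apply/matrixP => a b; rewrite !mxE. Qed.

(** The identity d_A F = 0 for F = dA + A /\ A, valid for arbitrary connection matrices: second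
    derivatives cancel in pairs because the derivations commute, and the remaining terms cancel as
    noncommutative words. *)
Lemma bianchi_curv m i j :
  covE m (curv i j) + covE i (curv j m) + covE j (curv m i) = 0.
Proof.
rewrite /covE /curv; move: (Gamma m) (Gamma i) (Gamma j) => Gm Gi Gj.
rewrite !(map_derD (dD _), map_derN (dD _), map_derM (dD _)).
rewrite !(mulmxDl, mulmxDr, mulmxBl, mulmxBr, mulNmx, mulmxN) !mulmxA.
rewrite (dmC m i) (dmC m j) (dmC i j).
by apply/matrixP => a b; rewrite !(addmxE, oppmxE) [RHS]mxE; ring.
Qed.

(** The Ricci identity for the parallel tensor g^-1: expanding d_i d_j g^-1 = d_j d_i g^-1 by
    [der_inv] leaves the curvature acting on both upper indices. *)
Lemma curv_inv_antisym i j : curv i j *m gi = - (curv i j *m gi)^T.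
Proof.
have key : dm i (dm j gi) = dm j (dm i gi) := dmC i j gi.
move: key; rewrite !der_inv /curv !(map_derN (dD _)) !(map_derD (dD _)).
move: (Gamma i) (Gamma j) (der_inv i) (der_inv j) => Gi Gj dgi dgj.
rewrite !(map_derM (dD _)) -!map_trmx dgi dgj.
rewrite !(mulmxDl, mulmxDr, mulmxBl, mulmxBr, mulNmx, mulmxN) !mulmxA => key.
have trD (M N : 'M[A]_n) : (M + N)^T = M^T + N^T by exact: raddfD.
have trN (M : 'M[A]_n) : (- M)^T = - M^T by exact: raddfN.
rewrite !(trD, trN, trmx_mul) tr_inv !mulmxA.
apply/matrixP => a b; move/matrixP/(_ a b): key.
rewrite !(addmxE, oppmxE) => /eqP; rewrite -subr_eq0 => /eqP key.
by apply/eqP; rewrite -subr_eq0; apply/eqP; rewrite -[RHS]oppr0 -key; ring.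
Qed.

(* nabla_i X^i_j *)
Definition divX (X : 'M[A]_n) j : A :=
  \sum_i d i (X i j) + \sum_c \tr (Gamma c) * X c j - \tr (Gamma j *m X).

Let Riem i j : 'M[A]_n := curv i j *m gi.

Lemma RiemC i j : Riem i j = - Riem j i.
Proof. by rewrite /Riem curvC mulNmx. Qed.

Lemma Riem_antisym i j a b : Riem i j a b = - Riem i j b a.
Proof. by rewrite /Riem {1}curv_inv_antisym !mxE. Qed.

Lemma raised_RicE c m : (gi *m Ric) c m = \sum_a Riem a m a c.
Proof.
rewrite mxE; under eq_bigr do rewrite mxE mulr_sumr.
rewrite exchange_big; apply: eq_bigr => a _; rewrite mxE.
by apply: eq_bigr => k _; rewrite mulrC (entry_sym _ _ tr_inv).
Qed.

Lemma Riem_contract i c : \sum_j Riem i j c j = (gi *m Ric) c i.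
Proof.
rewrite raised_RicE; apply: eq_bigr => j _.
by rewrite RiemC oppmxE Riem_antisym opprK.
Qed.

Lemma sum_sym_antisym (X Y : 'I_n -> 'I_n -> A) :
  (forall i j, X i j = X j i) -> (forall i j, Y i j = - Y j i) ->
  \sum_i \sum_j X i j * Y i j = 0.
Proof.
move=> XC YC; set S := \sum_i _.
have SN : S = - S.
  rewrite {1}/S exchange_big -sumrN; apply: eq_bigr => i _ /=.
  by rewrite -sumrN; apply: eq_bigr => j _; rewrite XC YC mulrN.
by rewrite -[S]mul1r -half2 mulrDl {2}SN mulrN subrr.
Qed.

Lemma covBE i (M : 'M[A]_n) a b : covB i M a b =
  d i (M a b) + \sum_c Gamma i a c * M c b + \sum_c M a c * Gamma i b c.
Proof.
by rewrite !addmxE !mxE; congr (_ + _); apply: eq_bigr => c _; rewrite mxE.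
Qed.

Lemma tr_mulE (X Y : 'M[A]_n) : \tr (X *m Y) = \sum_i \sum_c X i c * Y c i.
Proof. by apply: eq_bigr => i _; rewrite mxE. Qed.

(* Contract the first upper index with i and the second with j. *)
Lemma contracted_bianchi m : divX (gi *m Ric) m + divX (gi *m Ric) m = d m Scal.
Proof.
set P := gi *m Ric.
have B i j : covB m (Riem i j) i j + covB i (Riem j m) i j
    + covB j (Riem m i) i j = 0.
  have /matrixP/(_ i j) := congr1 (mulmx^~ gi) (bianchi_curv m i j).
  by rewrite /= 2!mulmxDl -!covBM mul0mx !addmxE [RHS]mxE.
have : \sum_i \sum_j (covB m (Riem i j) i j + covB i (Riem j m) i j
    + covB j (Riem m i) i j) = 0.
  by rewrite big1 // => i _; rewrite big1.
under eq_bigr do rewrite !big_split /=; rewrite !big_split /=.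
(* The first cyclic term contracts to d_m Scal and two equal Gamma terms. Each of the other two
   gives minus the divergence of P without its term - tr (Gamma_m P); there one Gamma sum drops out
   because Gamma is symmetric and Riem antisymmetric in the summed indices. *)
have -> : \sum_i \sum_j covB m (Riem i j) i j =
    d m Scal + \tr (Gamma m *m P) + \tr (Gamma m *m P).
  under eq_bigr do under eq_bigr do rewrite covBE.
  under eq_bigr do rewrite !big_split /=; rewrite !big_split /=.
  congr (_ + _ + _).
  - rewrite /Scal /mxtrace (der_sum (dD _)) exchange_big.
    by apply: eq_bigr => j _; rewrite raised_RicE (der_sum (dD _)).
  - rewrite tr_mulE; apply: eq_bigr => i _; rewrite exchange_big.
    by apply: eq_bigr => c _; rewrite -mulr_sumr Riem_contract.
  rewrite tr_mulE exchange_big; apply: eq_bigr => j _ /=.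
  rewrite exchange_big; apply: eq_bigr => c _.
  by rewrite -mulr_suml -raised_RicE mulrC.
have -> : \sum_i \sum_j covB i (Riem j m) i j =
    - (\sum_i d i (P i m) + \sum_c \tr (Gamma c) * P c m).
  under eq_bigr do under eq_bigr do rewrite covBE.
  under eq_bigr do rewrite !big_split /=; rewrite !big_split /=.
  rewrite [X in _ + X](_ : _ = 0) ?addr0 ?opprD; last first.
    rewrite exchange_big big1 //= => j _.
    under eq_bigr do under eq_bigr do rewrite mulrC.
    by apply: sum_sym_antisym => a b; [exact: GammaC | exact: Riem_antisym].
  congr (_ + _).
    rewrite -sumrN; apply: eq_bigr => i _; rewrite raised_RicE (der_sum (dD _)) -sumrN.
    by apply: eq_bigr => j _; rewrite Riem_antisym (derN (dD _)).
  rewrite -sumrN; under eq_bigr do rewrite exchange_big /=.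
  rewrite exchange_big /=; apply: eq_bigr => c _.
  rewrite raised_RicE /mxtrace mulr_suml -sumrN; apply: eq_bigr => i _.
  rewrite GammaC -mulrN -sumrN mulr_sumr; apply: eq_bigr => j _.
  by rewrite Riem_antisym.
have -> : \sum_i \sum_j covB j (Riem m i) i j =
    - (\sum_i d i (P i m) + \sum_c \tr (Gamma c) * P c m).
  under eq_bigr do under eq_bigr do rewrite covBE.
  under eq_bigr do rewrite !big_split /=; rewrite !big_split /=.
  rewrite [X in _ + X + _](_ : _ = 0) ?addr0 ?opprD; last first.
    rewrite big1 //= => i _.
    by apply: sum_sym_antisym => a b; [exact: GammaC | exact: Riem_antisym].
  congr (_ + _).
    rewrite exchange_big -sumrN; apply: eq_bigr => j _.
    rewrite raised_RicE (der_sum (dD _)) -sumrN.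
    by apply: eq_bigr => i _; rewrite RiemC oppmxE (derN (dD _)).
  rewrite -sumrN; under eq_bigr do rewrite exchange_big /=.
  rewrite exchange_big /=; apply: eq_bigr => c _.
  rewrite raised_RicE /mxtrace -mulrN -sumrN exchange_big mulr_suml; apply: eq_bigr => j _ /=.
  rewrite mulr_sumr; apply: eq_bigr => i _.
  by rewrite RiemC oppmxE mulrC GammaC.
move=> eq0; apply/eqP; rewrite -subr_eq0 -oppr_eq0 -[X in _ == X]eq0 /divX.
by apply/eqP; ring.
Qed.

(** Links the divergence of an endomorphism, convenient for the algebra, to the contraction g^ia
    nabla_i h_al that defines delta; the two agree because raising an index commutes with nabla. *)
Lemma divX_cov (h : 'M[A]_n) l : divX (gi *m h) l =
  \sum_i (gi *m (dm i h - (Gamma i)^T *m h - h *m Gamma i)) i l.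
Proof.
rewrite /divX.
have -> : \tr (Gamma l *m (gi *m h)) = \sum_i (gi *m h *m Gamma i) i l.
  rewrite mxtrace_mulC; apply: eq_bigr => i _; rewrite !mxE.
  by apply: eq_bigr => c _; rewrite GammaC.
have -> : \sum_c \tr (Gamma c) * (gi *m h) c l =
    \sum_i (Gamma i *m (gi *m h)) i l.
  under eq_bigr do rewrite mulr_suml.
  rewrite exchange_big; apply: eq_bigr => i _; rewrite [RHS]mxE.
  by apply: eq_bigr => c _; rewrite GammaC.
rewrite -big_split -sumrB; apply: eq_bigr => i _ /=.
have -> : d i ((gi *m h) i l) = dm i (gi *m h) i l by rewrite [RHS]mxE.
rewrite (map_derM (dD i)) der_inv mulNmx !mulmxDl !(mulmxDr gi) !mulmxN !mulmxA.
by rewrite !(addmxE, oppmxE); ring.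
Qed.

Lemma divXZ f (X : 'M[A]_n) j :
  divX (f *: X) j = \sum_i d i f * X i j + f * divX X j.
Proof.
have e1 : \sum_i d i ((f *: X) i j) =
    \sum_i d i f * X i j + f * \sum_i d i (X i j).
  rewrite mulr_sumr -big_split; apply: eq_bigr => i _.
  by rewrite mxE (derM (dD _)).
have e2 : \sum_c \tr (Gamma c) * (f *: X) c j =
    f * \sum_c \tr (Gamma c) * X c j.
  by rewrite mulr_sumr; apply: eq_bigr => i _; rewrite mxE mulrCA.
rewrite /divX e1 e2 -scalemxAr mxtraceZ; ring.
Qed.

Lemma divXD (X Y : 'M[A]_n) j : divX (X + Y) j = divX X j + divX Y j.
Proof.
rewrite /divX mulmxDr mxtraceD.
under eq_bigr do rewrite mxE (derD (dD _)).
under [X in _ + X - _]eq_bigr do rewrite mxE mulrDr.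
by rewrite !big_split /=; ring.
Qed.

Lemma divX1 j : divX 1%:M j = 0.
Proof.
rewrite /divX mulmx1 big1 ?add0r => [|i _]; last by rewrite mxE (der_nat (dD _)).
rewrite (bigD1 j) //= mxE eqxx mulr1 big1 ?addr0 ?subrr // => i /negPf ij.
by rewrite mxE ij mulr0.
Qed.

(** * A metric varying under a further derivation: evolution of momentum and energy *)

Variable del : A -> A.
Hypothesis ddel : derivation del.
Hypothesis delC : forall i a, del (d i a) = d i (del a).

Let h := map_mx del g.
(** Up to a constant factor this is the shape operator of the slices of the cylinder. [expansion] is
    the logarithmic derivative of det g along [del], and [momentum] is delta^- h, since delta h is
    minus the divergence of K. *)
Definition shape_op : 'M[A]_n := gi *m h.
Local Notation K := shape_op.
Definition expansion : A := \tr K.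
Local Notation th := expansion.
Definition momentum j : A := d j th - divX K j.

Let hT : h^T = h. Proof. by rewrite /h map_trmx gT. Qed.

Let delm_inv : map_mx del gi = - (K *m gi).
Proof. by rewrite (map_der_inv ddel ggi). Qed.

Let KgiT : (K *m gi)^T = K *m gi.
Proof. by rewrite /K !trmx_mul tr_inv hT mulmxA. Qed.

Lemma del_half : del half = 0. Proof. exact: (der_half ddel half2). Qed.

Lemma del_tr_Gamma i : del (\tr (Gamma i)) = half * d i th.
Proof.
rewrite tr_Gamma1 (derM ddel) del_half mul0r add0r; congr (_ * _).
exact: tr_logder_comm.
Qed.

(** The rates - theta of x^2 and theta of det g cancel. Squaring x keeps the square root of det g
    out of the ring. *)
Lemma conserved_density x : del x = - (half * th) * x ->
  del (x * x * \det g) = 0.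
Proof.
have adjE : \adj g = \det g *: gi.
  by rewrite -[LHS]mul1mx -mulmx_inv -mulmxA mul_mx_adj mul_mx_scalar.
have ddet : del (\det g) = \det g * th.
  by rewrite (der_det ddel) adjE -scalemxAl mxtraceZ.
rewrite !(derM ddel) ddet => ->.
transitivity ((1 - (half + half)) * (x * x * (\det g * th))); first by ring.
by rewrite half2 subrr mul0r.
Qed.

Lemma del_dm i M : map_mx del (dm i M) = dm i (map_mx del M) :> 'M[A]_n.
Proof. by apply/matrixP => a b; rewrite !mxE. Qed.

Let dK_del (D : A -> A) : derivation D -> map_mx D K =
  gi *m map_mx D h - gi *m map_mx D g *m K.
Proof.
move=> dDD; rewrite /K (map_derM dDD) (map_der_inv dDD ggi) mulNmx addrC.
by rewrite !mulmxA.
Qed.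

Lemma tr_dK_K (D : A -> A) : derivation D ->
  D (\tr (K *m K)) = \tr (K *m map_mx D K) + \tr (K *m map_mx D K).
Proof.
move=> dDD; rewrite (der_tr dDD) (map_derM dDD) mxtraceD; congr (_ + _).
exact: mxtrace_mulC.
Qed.

(** Besides K, only the connection varies. The term with tr Gamma_c yields half of K^c_j d_c theta.
    Since K is self-adjoint, tr (Gamma_j K) sees only d_j g, and its variation yields half of tr (K
    d_j K), a quarter of d_j tr K^2. *)
Lemma del_divX_shape j : del (divX K j) = divX (map_mx del K) j
  + half * (\sum_c d c th * K c j) - half * half * d j (\tr (K *m K)).
Proof.
rewrite {1}/divX (tr_Gamma j KgiT) (derB ddel) (derD ddel) (derM ddel half) del_half.
rewrite mul0r add0r (der_tr ddel) (map_derM ddel) !(der_sum ddel).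
rewrite /divX (tr_Gamma j (X := map_mx del K)); last first.
  rewrite (dK_del ddel) mulmxBl /K !mulmxA.
  have trB (M N : 'M[A]_n) : (M - N)^T = M^T - N^T by exact: raddfB.
  by rewrite trB !trmx_mul tr_inv -/h map_trmx hT !mulmxA.
have -> : \sum_i del (d i (K i j)) = \sum_i d i (map_mx del K i j).
  by apply: eq_bigr => i _; rewrite delC [in RHS]mxE.
have -> : \sum_c del (\tr (Gamma c) * K c j) =
    half * (\sum_c d c th * K c j) + \sum_c \tr (Gamma c) * map_mx del K c j.
  rewrite mulr_sumr -big_split; apply: eq_bigr => c _.
  by rewrite (derM ddel) del_tr_Gamma [map_mx del K c j]mxE mulrA.
rewrite mxtraceD.
have -> : \tr (map_mx del (gi *m dm j g) *m K) = \tr (K *m dm j K).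
  rewrite (map_derM ddel) delm_inv del_dm (dK_del (dD j)) !mulNmx -/h.
  rewrite mulmxDl mulNmx mulmxBr !raddfD /= !raddfN /= addrC; congr (_ - _).
    exact: mxtrace_mulC.
  by rewrite !mulmxA.
have -> : half * half * d j (\tr (K *m K)) = half * \tr (K *m dm j K).
  by rewrite tr_dK_K // -mulrA mulrDr -mulrDl half2 mul1r.
ring.
Qed.

(* evolK is the evolution equation for K = g^-1 g', with a = 2 alpha and
   k = alpha lambda (n - 1). *)
Let P := gi *m Ric.
Let N := \tr (K *m K) - th * th.
Variables (a k f : A).
Hypothesis da : forall i, d i a = 0.
Hypothesis dela : del a = 0.
Hypothesis dk : forall i, d i k = 0.
Hypothesis delk : del k = 0.
Hypothesis evolK :
  map_mx del K = (- (half * th)) *: K + f *: 1%:M + a *: P.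
(** Only (n - 1) f has to be known: theta' carries n f while K' carries f, and both conservation
    laws involve the difference. *)
Hypothesis evolf : (n%:R - 1) * f = - (half * half * N) - half * a * Scal - k.

Lemma del_expansion : del th = - (half * th) * th + n%:R * f + a * Scal.
Proof.
by rewrite (der_tr ddel) evolK !mxtraceD !mxtraceZ mxtrace1 (mulrC f).
Qed.

(** The difference n d_j f - d_j f, read off from [evolf], cancels the quarter of d_j tr K^2 from
    [del_divX_shape] and half of a d_j Scal; the Bianchi identity turns a div P into the other half.
    The two sums of K^c_j d_c theta cancel as well, and - (theta / 2) (d_j theta - div K_j) is
    left. *)
Lemma momentum_evolution j : del (momentum j) = - (half * th) * momentum j.
Proof.
have nf : d j (n%:R * f) = d j f - half * half * d j (\tr (K *m K))
    + half * half * (th * d j th + th * d j th) - half * a * d j Scal.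
  have -> : n%:R * f = f + (n%:R - 1) * f by ring.
  rewrite evolf /N !(derD (dD _), derN (dD _), derM (dD _), da, dk).
  by rewrite !(der_half (dD _) half2); ring.
have bian : a * divX P j = half * a * d j Scal.
  rewrite -contracted_bianchi -/P -[LHS]mul1r -half2; ring.
rewrite /momentum (derB ddel) delC del_divX_shape evolK !divXD !divXZ divX1 bian.
rewrite del_expansion !(derD (dD _)) nf.
rewrite !(derN (dD _), derM (dD _), der_half (dD _) half2, da).
have -> : \sum_i d i f * 1%:M i j = d j f.
  rewrite (bigD1 j) //= mxE eqxx mulr1 big1 ?addr0 // => i /negPf ij.
  by rewrite mxE ij mulr0.
have -> : \sum_i d i a * P i j = 0 by rewrite big1 // => i _; rewrite da mul0r.
have -> : \sum_i d i (- (half * th)) * K i j = - (half * \sum_i d i th * K i j).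
  rewrite mulr_sumr -sumrN; apply: eq_bigr => i _.
  by rewrite (derN (dD _)) (derM (dD _)) (der_half (dD _) half2); ring.
have q x : half * half * (x + x) = half * x.
  by rewrite -mulrA mulrDr -mulrDl half2 mul1r.
have -> : a * d j Scal = half * a * d j Scal + half * a * d j Scal.
  by rewrite -!mulrA -mulrDl half2 mul1r.
rewrite q; ring.
Qed.

(* Palatini: the divergence of W is the variation of the scalar curvature without
   its Ricci term, and W is the metric dual of - momentum. *)
Let W b : A := \sum_j (map_mx del (Gamma j) *m gi) b j
  - \sum_j (map_mx del (Gamma j) *m gi) j b.

(** Palatini's identity: the variation of F = dA + A /\ A is the covariant exterior derivative of
    the variation of A. After contraction with g^-1 the Gamma terms reassemble into a divergence. *)
Lemma tr_inv_del_Ric :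
  \tr (gi *m map_mx del Ric) = \sum_b d b (W b) + \sum_b \tr (Gamma b) * W b.
Proof.
pose S j := map_mx del (Gamma j) *m gi.
have dcurv i j : map_mx del (curv i j) *m gi = covB i (S j) - covB j (S i).
  rewrite !covBM -mulmxBl; congr (_ *m _); rewrite /curv /covE -!del_dm.
  move: (Gamma i) (Gamma j) => Gi Gj.
  rewrite !(map_derD ddel, map_derN ddel, map_derM ddel).
  by apply/matrixP => u v; rewrite !(addmxE, oppmxE); ring.
transitivity (\sum_i \sum_j (covB i (S j) i j - covB j (S i) i j)).
  rewrite exchange_big tr_mulE; apply: eq_bigr => j _ /=.
  transitivity (\sum_i (map_mx del (curv i j) *m gi) i j); last first.
    by apply: eq_bigr => i _; rewrite dcurv addmxE oppmxE.
  under eq_bigr do rewrite !mxE (der_sum ddel) mulr_sumr.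
  rewrite exchange_big; apply: eq_bigr => i _; rewrite [RHS]mxE.
  apply: eq_bigr => c _.
  by rewrite [map_mx _ _ _ _]mxE mulrC (entry_sym j c tr_inv).
under eq_bigr do under eq_bigr do rewrite !covBE.
under eq_bigr do rewrite sumrB !big_split /=.
rewrite sumrB !big_split /=.
have -> : \sum_i \sum_j \sum_c Gamma j i c * S i c j =
    \sum_i \sum_j \sum_c S j i c * Gamma i j c.
  under eq_bigr do rewrite exchange_big /=.
  rewrite exchange_big; apply: eq_bigr => c _; apply: eq_bigr => i _ /=.
  by apply: eq_bigr => j _; rewrite mulrC GammaC.
have -> : \sum_b d b (W b) = \sum_i \sum_j d i (S j i j) - \sum_i \sum_j d j (S i i j).
  rewrite [X in _ - X]exchange_big -sumrB; apply: eq_bigr => i _ /=.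
  by rewrite (derB (dD _)) !(der_sum (dD _)).
have -> : \sum_b \tr (Gamma b) * W b =
    \sum_i \sum_j \sum_c Gamma i i c * S j c j - \sum_i \sum_j \sum_c S i i c * Gamma j j c.
  transitivity (\sum_b (\sum_i \sum_j Gamma i i b * S j b j
                       - \sum_i \sum_j S i i b * Gamma j j b)).
    apply: eq_bigr => b _; rewrite /W mulrBr; congr (_ - _).
      rewrite mulr_suml; apply: eq_bigr => i _; rewrite mulr_sumr.
      by apply: eq_bigr => j _; rewrite GammaC.
    rewrite mulrC mulr_suml; apply: eq_bigr => i _; rewrite mulr_sumr.
    by apply: eq_bigr => j _; rewrite (GammaC b).
  rewrite sumrB; congr (_ - _); rewrite exchange_big; apply: eq_bigr => i _;
    exact: exchange_big.
ring.
Qed.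

(** The two contractions of the varied connection are div K_l - d_l theta / 2 and d_l theta / 2;
    their difference is minus the momentum. *)
Lemma mul_W l : \sum_b g l b * W b = - momentum l.
Proof.
pose S j := map_mx del (Gamma j) *m gi.
have gS j : g *m S j = (map_mx del (lowerGamma j) - h *m Gamma j) *m gi.
  rewrite /S mulmxA; congr (_ *m _); rewrite -mul_lowerGamma (map_derM ddel) -/h.
  by rewrite [X in _ = X - _]addrC addrK.
have -> : \sum_b g l b * W b = \sum_j (g *m S j) l j - \sum_j (S j *m g) j l.
  transitivity (\sum_b (\sum_j g l b * S j b j - \sum_j S j j b * g b l)).
    apply: eq_bigr => b _; rewrite mulrBr !mulr_sumr; congr (_ - _).
    by apply: eq_bigr => j _; rewrite mulrC (entry_sym l b gT).
  rewrite sumrB; congr (_ - _); rewrite exchange_big; apply: eq_bigr => j _;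
    by rewrite mxE.
have -> : \sum_j (S j *m g) j l = half * d l th.
  rewrite -del_tr_Gamma (der_sum ddel); apply: eq_bigr => j _.
  by rewrite /S -mulmxA mulmx_inv mulmx1 mxE GammaC.
have -> : \sum_j (g *m S j) l j = \sum_j (gi *m dm j h) j l
    - half * \tr (gi *m dm l h) - \sum_j (gi *m (Gamma j)^T *m h) j l.
  rewrite (eq_bigr (fun j => (map_mx del (lowerGamma j) *m gi) l j
      - (h *m Gamma j *m gi) l j)); last first.
    by move=> j _; rewrite gS mulmxBl addmxE oppmxE.
  rewrite sumrB; congr (_ - _); last first.
    apply: eq_bigr => j _; rewrite -[in RHS]tr_inv -[in RHS]hT -!trmx_mul.
    by rewrite [RHS]mxE mulmxA.
  rewrite tr_mulE.
  transitivity (\sum_j \sum_b half * (gi j b * d j (h b l) + gi j b * d b (h j l)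
      - gi j b * d l (h j b))).
    apply: eq_bigr => j _; rewrite mxE; apply: eq_bigr => b _; rewrite !mxE.
    rewrite (derM ddel) del_half (derB ddel) (derD ddel) !delC (entry_sym b j tr_inv).
    ring.
  under eq_bigr do rewrite -mulr_sumr sumrB big_split /=.
  rewrite -mulr_sumr sumrB big_split /= mulrBr; congr (_ - _).
    set T := \sum_j _; have -> : \sum_j (gi *m dm j h) j l = T.
      by apply: eq_bigr => j _; rewrite mxE; apply: eq_bigr => b _; rewrite [in LHS]mxE.
    rewrite [X in _ + X](_ : _ = T) ?mulrDr -?mulrDl ?half2 ?mul1r //.
    rewrite exchange_big; apply: eq_bigr => j _; apply: eq_bigr => b _.
    by rewrite (entry_sym b j tr_inv).
  congr (_ * _); apply: eq_bigr => j _; apply: eq_bigr => b _.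
  by rewrite [dm l h b j]mxE (entry_sym j b hT).
rewrite /momentum divX_cov.
have -> : \sum_i (gi *m (dm i h - (Gamma i)^T *m h - h *m Gamma i)) i l =
    \sum_j (gi *m dm j h) j l - \sum_j (gi *m (Gamma j)^T *m h) j l
    - \tr (Gamma l *m K).
  have -> : \tr (Gamma l *m K) = \sum_i (K *m Gamma i) i l.
    rewrite mxtrace_mulC; apply: eq_bigr => i _; rewrite !mxE.
    by apply: eq_bigr => c _; rewrite GammaC.
  rewrite -!sumrB; apply: eq_bigr => i _.
  by rewrite !mulmxBr !mulmxA !(addmxE, oppmxE).
have dth : d l th = \tr (gi *m dm l h) - \tr (gi *m dm l g *m K).
  by rewrite (der_tr (dD l)) (dK_del (dD l)) raddfB.
rewrite (tr_Gamma l KgiT) -[X in X - (_ - _ - _)]mul1r -half2 dth; ring.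
Qed.

Lemma W_eq0 : (forall l, momentum l = 0) -> forall b, W b = 0.
Proof.
move=> m0 b; have : \sum_l gi b l * (\sum_c g l c * W c) = W b.
  transitivity (\sum_c (gi *m g) b c * W c).
    under eq_bigr do rewrite mulr_sumr.
    rewrite exchange_big; apply: eq_bigr => c _; rewrite mxE mulr_suml.
    by apply: eq_bigr => l _; rewrite mulrA.
  rewrite mulmx_inv (bigD1 b) //= mxE eqxx mul1r big1 ?addr0 // => i ib.
  by rewrite mxE eq_sym (negPf ib) mul0r.
by move=> <-; rewrite big1 // => l _; rewrite mul_W m0 oppr0 mulr0.
Qed.

Definition energy : A := half * N + a * Scal - (k + k).

(** With W = 0 the derivative of Scal is - tr (K P), which cancels the term a tr (K P) coming from
    K'. The rest is - theta (N / 2 + a Scal + (n - 1) f), and [evolf] turns the bracket into half of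
    the energy. *)
Lemma energy_evolution : (forall l, momentum l = 0) ->
  del energy = - (half * th) * energy.
Proof.
move=> m0.
have dS : del Scal = - \tr (K *m P).
  rewrite (der_tr ddel) (map_derM ddel) delm_inv mulNmx mxtraceD tr_inv_del_Ric.
  rewrite !big1 ?addr0 => [|b _|b _]; rewrite ?W_eq0 ?(der0 (dD _)) ?mulr0 //.
  by rewrite raddfN /= /P mulmxA.
have trKdK : \tr (K *m map_mx del K) =
    - (half * th) * \tr (K *m K) + f * th + a * \tr (K *m P).
  rewrite evolK !mulmxDr -!scalemxAr !mxtraceD !mxtraceZ mulmx1.
  by [].
rewrite /energy !(derB ddel, derD ddel, derM ddel) del_half dela delk dS tr_dK_K //.
rewrite trKdK del_expansion.
have q x : half * (x + x) = x by rewrite mulrDr -mulrDl half2 mul1r.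
have -> : half * (- (half * th) * \tr (K *m K) + f * th + a * \tr (K *m P)
   + (- (half * th) * \tr (K *m K) + f * th + a * \tr (K *m P))
   - ((- (half * th) * th + n%:R * f + a * Scal) * th +
      th * (- (half * th) * th + n%:R * f + a * Scal))) =
   - (half * th) * N - (n%:R - 1) * f * th + a * \tr (K *m P) - a * Scal * th.
  by rewrite -[RHS]q /N; ring.
rewrite evolf.
(* For [ring] the element [half] is a free symbol, so the discrepancy of the two sides is supplied
   as a multiple of half + half - 1. *)
have e0 : (half + half - 1) * (half * th * N + a * Scal * th - k * th) = 0.
  by rewrite half2 subrr mul0r.
rewrite -[RHS]addr0 -[X in _ = _ + X]e0; ring.
Qed.

End Metric.

(** * The Ricci tensor of the cylinder *)

Section Cylinder.
Variables (A : comNzRingType) (n : nat) (D : 'I_(1 + n) -> A -> A) (half : A).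
Variables (g gi : 'M[A]_n) (al ali : A).
Hypothesis dD : forall i, derivation (D i).
Hypothesis dC : forall i j a, D i (D j a) = D j (D i a).
Hypothesis half2 : half + half = 1.
Hypothesis gT : g^T = g.
Hypothesis ggi : g *m gi = 1%:M.
Hypothesis alK : al * ali = 1.
Hypothesis Dal : forall i, D i al = 0.

(* o is the time index and r i the i-th space index. *)
Local Notation o := (lshift n (ord0 : 'I_1)).
Local Notation r := (@rshift 1 n).
Let d i := D (r i).
Let del := D o.
Let h := map_mx del g.
Local Notation K := (shape_op g gi del).
Local Notation th := (expansion g gi del).

Definition cylG : 'M[A]_(1 + n) := block_mx al%:M 0 0 g.
Definition cylGi : 'M[A]_(1 + n) := block_mx ali%:M 0 0 gi.

Lemma cylG_tr : cylG^T = cylG.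
Proof. by rewrite tr_block_mx tr_scalar_mx gT !trmx0. Qed.

Lemma cylGK : cylG *m cylGi = 1%:M.
Proof.
rewrite mulmx_block !mul0mx !mulmx0 !addr0 add0r ggi -scalar_mxM alK.
by rewrite -scalar_mx_block.
Qed.

Let Gam := Gamma D half cylG cylGi.
Let Low := lowerGamma D half cylG.
Let hT : h^T = h. Proof. by rewrite /h map_trmx gT. Qed.

Lemma sum_cyl (F : 'I_(1 + n) -> A) : \sum_a F a = F o + \sum_i F (r i).
Proof. by rewrite big_split_ord big_ord1. Qed.

Lemma cylGoo : cylG o o = al.
Proof. by rewrite block_mxEul mxE eqxx mulr1n. Qed.
Lemma cylGor i : cylG o (r i) = 0. Proof. by rewrite block_mxEur mxE. Qed.
Lemma cylGro i : cylG (r i) o = 0. Proof. by rewrite block_mxEdl mxE. Qed.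
Lemma cylGrr i j : cylG (r i) (r j) = g i j. Proof. by rewrite block_mxEdr. Qed.
Lemma cylGioo : cylGi o o = ali.
Proof. by rewrite block_mxEul mxE eqxx mulr1n. Qed.
Lemma cylGior i : cylGi o (r i) = 0. Proof. by rewrite block_mxEur mxE. Qed.
Lemma cylGiro i : cylGi (r i) o = 0. Proof. by rewrite block_mxEdl mxE. Qed.
Lemma cylGirr i j : cylGi (r i) (r j) = gi i j. Proof. by rewrite block_mxEdr. Qed.
Let cylE := (cylGoo, cylGor, cylGro, cylGrr).
Let cyliE := (cylGioo, cylGior, cylGiro, cylGirr).

Let D0 i : D i 0 = 0. Proof. exact: der0. Qed.

Lemma Gamo i b : Gam i o b = ali * Low i o b.
Proof.
rewrite /Gam /Gamma mxE sum_cyl cyliE big1 ?addr0 // => k _.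
by rewrite cyliE mul0r.
Qed.

Lemma Gamr i a b : Gam i (r a) b = \sum_k gi a k * Low i (r k) b.
Proof.
rewrite /Gam /Gamma mxE sum_cyl cyliE mul0r add0r.
by apply: eq_bigr => k _; rewrite cyliE.
Qed.

Lemma Gam_ooo : Gam o o o = 0.
Proof. by rewrite Gamo mxE !cylE !Dal !(addr0, oppr0, mulr0). Qed.

Lemma Gam_oor b : Gam o o (r b) = 0.
Proof. by rewrite Gamo mxE !cylE ?Dal !(D0, addr0, oppr0, mulr0). Qed.

Lemma Gam_oro a : Gam o (r a) o = 0.
Proof.
rewrite Gamr big1 // => k _.
by rewrite mxE !cylE ?Dal !(D0, addr0, oppr0, mulr0).
Qed.

Lemma Gam_orr a b : Gam o (r a) (r b) = half * K a b.
Proof.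
rewrite Gamr mxE mulr_sumr; apply: eq_bigr => k _.
rewrite [Low _ _ _]mxE [map_mx del g _ _]mxE !cylE !D0 subr0 addr0 mulrCA -/del.
by rewrite (entry_sym b k gT).
Qed.

Lemma Gam_roo i : Gam (r i) o o = 0.
Proof. by rewrite Gamo mxE !cylE ?Dal !(D0, addr0, oppr0, mulr0). Qed.

Lemma Gam_ror i b : Gam (r i) o (r b) = - (half * ali * h i b).
Proof. by rewrite Gamo [Low _ _ _]mxE [h _ _]mxE !cylE !D0 !add0r -/del; ring. Qed.

Lemma Gam_rro i a : Gam (r i) (r a) o = half * K a i.
Proof.
rewrite Gamr mxE mulr_sumr; apply: eq_bigr => k _.
rewrite [Low _ _ _]mxE [map_mx del g _ _]mxE !cylE !D0 subr0 add0r mulrCA -/del.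
by rewrite (entry_sym i k gT).
Qed.

Lemma Gam_rrr i a b : Gam (r i) (r a) (r b) = Gamma d half g gi i a b.
Proof.
rewrite Gamr [RHS]mxE; apply: eq_bigr => k _.
by rewrite [Low _ _ _]mxE [lowerGamma _ _ _ _ _ _]mxE !cylE.
Qed.

Let GamE := (Gam_ooo, Gam_oor, Gam_oro, Gam_orr, Gam_roo, Gam_ror, Gam_rro, Gam_rrr).

Local Notation cylRic := (Ric D half cylG cylGi).

Let dhalf i x : D i (half * x) = half * D i x.
Proof. by rewrite (derM (dD _)) (der_half (dD _) half2) mul0r add0r. Qed.

Lemma cylRic_sym i j : cylRic i j = cylRic j i.
Proof. exact/entry_sym/(Ric_sym dD dC half2 cylG_tr cylGK). Qed.

(** The Raychaudhuri equation of the slices. *)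
Lemma cylRic_oo : cylRic o o = - (half * del th) - half * half * \tr (K *m K).
Proof.
rewrite RicE -/Gam !sum_cyl !GamE subrr add0r.
rewrite (eq_bigr (fun a => - (half * del (K a a)))); last first.
  by move=> a _; rewrite !GamE D0 add0r dhalf.
rewrite sumrN -mulr_sumr -(der_sum (dD _)); congr (_ + _).
rewrite big1 => [|b _]; last by rewrite !GamE !(mulr0, mul0r) subrr.
rewrite !(mulr0, mul0r) subrr !add0r.
rewrite tr_mulE mulr_sumr -sumrN; apply: eq_bigr => a _.
rewrite sum_cyl !GamE !(mulr0, mul0r) subrr add0r mulr_sumr -sumrN.
by apply: eq_bigr => b _; rewrite !GamE; ring.
Qed.

(** The traced Codazzi equation. *)
Lemma cylRic_or j : cylRic o (r j) =
  half * (divX d half g gi K j - d j th).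
Proof.
rewrite RicE -/Gam !sum_cyl !GamE !D0 subrr add0r.
have -> : \sum_b (Gam o o (r b) * Gam (r j) (r b) o -
    Gam (r j) o (r b) * Gam o (r b) o) = 0.
  by rewrite big1 // => b _; rewrite !GamE !(mulr0, mul0r) subrr.
rewrite !(mulr0, mul0r) subrr !add0r.
rewrite (eq_bigr (fun a => half * (d a (K a j)) - half * d j (K a a))); last first.
  by move=> a _; rewrite !GamE !dhalf.
rewrite sumrB -!mulr_sumr -(der_sum (dD _)) -/th -/(\tr K).
rewrite [X in _ + X](_ : _ = half * (\sum_c \tr (Gamma d half g gi c) * K c j)
    - half * \tr (Gamma d half g gi j *m K)); last first.
  rewrite tr_mulE.
  transitivity (\sum_a (half * (\sum_b Gamma d half g gi a a b * K b j) -
    half * (\sum_b Gamma d half g gi j a b * K b a))).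
    apply: eq_bigr => a _; rewrite sum_cyl !GamE !(mulr0, mul0r) subrr add0r.
    rewrite !mulr_sumr -sumrB; apply: eq_bigr => b _.
    by rewrite !GamE; ring.
  rewrite sumrB -!mulr_sumr; congr (_ * _ - _).
  rewrite exchange_big; apply: eq_bigr => b _ /=.
  rewrite mulr_suml; apply: eq_bigr => a _; congr (_ * _).
  exact: GammaC.
rewrite -[D (r j)]/(d j) /divX /expansion; ring.
Qed.

(** The traced Gauss equation combined with the Riccati equation for the shape operator. *)
Lemma cylRic_rr i j : cylRic (r i) (r j) = Ric d half g gi i j
  - half * ali * (map_mx del h - h *m K + (half * th) *: h) i j.
Proof.
have Dali k : D k ali = 0.
  have := der1 (dD k); rewrite -alK (derM (dD k)) Dal mul0r add0r => /(congr1 ( *%R ali)).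
  by rewrite mulrA (mulrC ali) alK mul1r mulr0.
rewrite !RicE -/Gam !sum_cyl !GamE D0 subr0 !(mulr0, mul0r) subr0 add0r.
rewrite (eq_bigr (fun a => d a (Gamma d half g gi j a i) - d j (Gamma d half g gi a a i)));
  last by move=> a _; rewrite !GamE.
set S1 := (X in _ = X + _ - _); set S2 := (X in _ = _ + X - _).
have -> : D o (- (half * ali * h j i)) = - (half * ali * map_mx del h i j).
  rewrite (derN (dD _)) -mulrA dhalf (derM (dD _)) Dali mul0r add0r mulrA.
  by rewrite [map_mx del h i j]mxE (entry_sym i j hT).
have -> : \sum_b (Gam o o (r b) * Gam (r j) (r b) (r i) -
   Gam (r j) o (r b) * Gam o (r b) (r i)) =
   half * half * ali * (h *m K) i j.
  have -> : (h *m K) i j = (h *m K) j i.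
    by apply: entry_sym; rewrite !trmx_mul (tr_inv gT ggi) -/h hT mulmxA.
  rewrite mxE mulr_sumr; apply: eq_bigr => b _; rewrite !GamE; ring.
have -> : \sum_a \sum_b (Gam (r a) (r a) b * Gam (r j) b (r i) -
    Gam (r j) (r a) b * Gam (r a) b (r i)) =
    S2 - half * half * ali * th * h i j + half * half * ali * (h *m K) i j.
  transitivity (\sum_a (- (half * half * ali * h i j) * K a a
     + half * half * ali * (h i a * K a j) +
    \sum_b (Gamma d half g gi a a b * Gamma d half g gi j b i -
            Gamma d half g gi j a b * Gamma d half g gi a b i))).
    apply: eq_bigr => a _; rewrite sum_cyl; congr (_ + _).
      by rewrite !GamE (entry_sym j i hT) (entry_sym a i hT); ring.
    by apply: eq_bigr => b _; rewrite !GamE.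
  rewrite !big_split /= -!mulr_sumr [X in _ + X](_ : _ = S2) //.
  have -> : \sum_a h i a * K a j = (h *m K) i j by rewrite [RHS]mxE.
  rewrite -[\sum_a K a a]/th; ring.
rewrite [X in _ + X + _ = _](_ : _ = S1) //.
rewrite !(addmxE, oppmxE) [((_ *: _) : 'M[A]_n) i j]mxE.
have q x : half * half * ali * x + half * half * ali * x = half * ali * x.
  by rewrite -!mulrA -mulrDr -mulrDl half2 mul1r.
rewrite [half * ali * (_ + _)]mulrDr mulrBr -[half * ali * (h *m K) i j]q; ring.
Qed.

(** [l] is lambda and [nu] is 1/(4(n-1)), the coefficient in the Christoffel map; nu + nu is then
    the coefficient of the scalar curvature in the gradient. *)
Variables (l nu : A).
Hypothesis Dl : forall i, D i l = 0.
Hypothesis nuE : nu * (n%:R - 1) = half * half.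
Let a := al + al.
Let k := al * l * (n%:R - 1).
Let N := \tr (K *m K) - th * th.
Let S := Scal d half g gi.
Let f := - (nu * N) - a * ((nu + nu) * S) - al * l.
Hypothesis evol : map_mx del h = h *m K - (half * th) *: h - (nu * N) *: g
  - a *: (- Ric d half g gi + ((nu + nu) * S) *: g + (half * l) *: g).

Let Da i : D i a = 0. Proof. by rewrite (derD (dD i)) Dal addr0. Qed.
Let Dk i : D i k = 0.
Proof.
rewrite !(derM (dD i)) (derB (dD i)) (der_nat (dD i)) (der1 (dD i)) Dal Dl.
by rewrite !(mul0r, mulr0, addr0, subrr).
Qed.

(** Since K' = g^-1 h' - K^2, the term h g^-1 h of the Christoffel map is absorbed by the derivative
    of g^-1; f collects the multiples of g. *)
Let evolK : map_mx del K =
  (- (half * th)) *: K + f *: 1%:M + a *: (gi *m Ric d half g gi).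
Proof.
rewrite /shape_op (map_derM (dD _)) (map_der_inv (dD _) ggi) -/h evol.
have e1 : a * (half * l) = al * l.
  by rewrite mulrA mulrDl -mulrDr half2 mulr1.
rewrite !(mulmxDr, mulmxN) -!scalemxAr (mulmx_inv ggi) !(mulmxDr, mulmxN) -!scalemxAr.
rewrite (mulmx_inv ggi) /f -e1 /shape_op mulNmx !mulmxA -/h.
apply/matrixP => u v; rewrite !mxE; ring.
Qed.

Let evolf : (n%:R - 1) * f = - (half * half * N) - half * a * S - k.
Proof.
have q : half * half + half * half = half by rewrite -mulrDr half2 mulr1.
have -> : half * a * S = (nu * (n%:R - 1) + nu * (n%:R - 1)) * a * S.
  by rewrite nuE q.
rewrite -nuE /f /k; ring.
Qed.

Let ddi i : derivation (d i). Proof. exact: dD. Qed.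
Let ddC i j x : d i (d j x) = d j (d i x). Proof. exact: dC. Qed.

Local Notation mom := (momentum d half g gi del).
Local Notation en := (energy d half g gi del a k).

Lemma momentum_cons j : del (mom j) = - (half * th) * mom j.
Proof.
apply: (momentum_evolution ddi ddC half2 gT ggi (dD _) _ _ _ evolK evolf) => *;
  [exact: dC | exact: Da | exact: Dk].
Qed.

Lemma energy_cons : (forall i, mom i = 0) -> del en = - (half * th) * en.
Proof.
apply: (energy_evolution ddi half2 gT ggi (dD _) _ _ _ evolK evolf) => *;
  [exact: dC | exact: Da | exact: Dk].
Qed.

Lemma cylRic_einstein :
  (forall i, mom i = 0) -> en = 0 -> cylRic = l *: cylG.
Proof.
move=> m0 e0.
have hN : half * N = k + k - a * S.
  by apply: subr0_eq; rewrite -[RHS]e0 /energy -/N -/S; ring.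
have NE : N = (k + k + k + k) - (a * S + a * S).
  by rewrite -[N]mul1r -half2 mulrDl hN; ring.
apply/matrixP => i j; rewrite [RHS]mxE.
have ha : half * a = al by rewrite mulrDr -mulrDl half2 mul1r.
have half_double x : half * (x + x) = x by rewrite mulrDr -mulrDl half2 mul1r.
have qnu : (nu + nu + nu + nu) * (n%:R - 1) = 1.
  by rewrite !mulrDl nuE -addrA -mulrDr half2 mulr1.
have qk : (nu + nu + nu + nu) * k = al * l.
  by rewrite -[RHS]mulr1 -qnu /k; ring.
(* On the zero set of the energy f is the constant - 2 alpha lambda. *)
have fE : f = - (al * l + al * l).
  rewrite /f NE -qk; ring.
case: (splitP i) => [i'|i'] ii; case: (splitP j) => [j'|j'] jj.
- have -> : i = o by apply: val_inj; rewrite /= ii (ord1 i').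
  have -> : j = o by apply: val_inj; rewrite /= jj (ord1 j').
  rewrite cylRic_oo cylGoo.
  have -> : del th = - (half * th) * th + n%:R * f + a * S.
    apply: (del_expansion (dD _) evolK).
  have -> : \tr (K *m K) = N + th * th by rewrite /N subrK.
  have -> : n%:R * f = f + (n%:R - 1) * f by ring.
  rewrite evolf fE.
  have -> : half * half * N = k - half * (a * S).
    rewrite NE (_ : _ - _ = (k + k - a * S) + (k + k - a * S)); last by ring.
    by rewrite -mulrA half_double mulrBr half_double.
  have -> : half * half * (N + th * th) = k - half * (a * S) + half * half * (th * th).
    rewrite mulrDr; congr (_ + _).
    rewrite NE (_ : _ - _ = (k + k - a * S) + (k + k - a * S)); last by ring.
    by rewrite -mulrA half_double mulrBr half_double.
  transitivity (half * (half * th * th - a * S + ((al * l + k) + (al * l + k)))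
      - (k - half * (a * S) + half * half * (th * th))); first by ring.
  rewrite mulrDr half_double; ring.
- have -> : i = o by apply: val_inj; rewrite /= ii (ord1 i').
  have -> : j = r j' by apply: val_inj.
  have := m0 j'; rewrite /momentum => /eqP; rewrite subr_eq0 => /eqP mj.
  by rewrite cylRic_or cylGor mulr0 mj subrr mulr0.
- have -> : j = o by apply: val_inj; rewrite /= jj (ord1 j').
  have -> : i = r i' by apply: val_inj.
  have := m0 i'; rewrite /momentum => /eqP; rewrite subr_eq0 => /eqP mj.
  by rewrite cylRic_sym cylRic_or cylGro mulr0 mj subrr mulr0.
have -> : i = r i' by apply: val_inj.
have -> : j = r j' by apply: val_inj.
rewrite cylRic_rr cylGrr evol.
have hal : half * ali * a = 1 by rewrite mulrAC ha alK.
(* In the spatial block the evolution equation cancels the Ricci tensor of g and contributes lambda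
   / 2; the energy constraint, in this form, contributes the other half. *)
have hN2 : half * ali * (nu * N) = half * l - (nu + nu) * S.
  rewrite NE; transitivity (half * ali * ((nu + nu + nu + nu) * k)
    - half * ali * a * ((nu + nu) * S)); first by ring.
  by rewrite hal mul1r qk mulrA -(mulrA half) (mulrC ali) alK mulr1.
rewrite !(addmxE, oppmxE) ![((_ *: _) : 'M[A]_n) i' j']mxE !(addmxE, oppmxE).
rewrite ![((_ *: _) : 'M[A]_n) i' j']mxE.
set R0 := Ric _ _ _ _ _ _; set G0 := g i' j'.
transitivity (R0 + half * ali * (nu * N) * G0 + half * ali * a *
  (- R0 + (nu + nu) * S * G0 + half * l * G0)); first by ring.
rewrite hal hN2 mul1r -[RHS]mul1r -half2; ring.
Qed.

End Cylinder.

(** * The ring of smooth functions on an open set *)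

Section DirectionalClass.
Context {R : realType} {m : nat}.
Variable V : set 'rV[R]_m.
Hypothesis V_open : open V.
Implicit Types (f g : 'rV[R]_m -> R).

Local Notation e i := (delta_mx (0 : 'I_1) i).

Lemma near_eq_on f g x : V x -> {in V, f =1 g} -> {near x, f =1 g}.
Proof.
move=> Vx fg; have := open_nbhs_nbhs (conj V_open Vx).
by apply: filterS => y Vy; apply: fg; rewrite inE.
Qed.

Lemma partial_ext i f g : {in V, f =1 g} -> {in V, partial i f =1 partial i g}.
Proof.
by move=> fg x /[!inE] Vx; apply: near_eq_derive; exact: near_eq_on.
Qed.

Arguments partial_ext {i f g}.

(* No joint continuity of the derivatives is required, only that the iterated
   coordinate derivatives exist and commute: this is all the algebra needs, and
   it holds for the components of a smooth curve of metrics almost by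
   definition. *)
Fixpoint ck k f : Prop :=
  if k is k'.+1 then
    [/\ forall x i, V x -> derivable f x (e i),
        (0 < k')%N -> forall x i j, V x ->
          partial i (partial j f) x = partial j (partial i f) x &
        forall i, ck k' (partial i f)]
  else True.

Definition cinfty f := forall k, ck k f.

Lemma ck_ext k f g : {in V, f =1 g} -> ck k f -> ck k g.
Proof.
elim: k f g => [//|k IHk] f g fg [df cf pf]; split.
- move=> x i Vx; apply: near_eq_derivable (df x i Vx); exact: near_eq_on.
- move=> k0 x i j Vx; have xV : x \in V by rewrite inE.
  rewrite -(partial_ext (partial_ext fg) _ xV) -[RHS](partial_ext (partial_ext fg) _ xV).
  exact: cf.
- by move=> i; apply: IHk (pf i); exact: partial_ext.
Qed.

Lemma ckS k f : ck k.+1 f -> ck k f.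
Proof.
elim: k f => [//|k IHk] f [df cf pf]; split; first exact: df.
  by move=> k0; apply: cf.
by move=> i; apply: IHk; exact: pf.
Qed.

Lemma partial_cst (c : R) i : partial i (fun _ : 'rV[R]_m => c) = fun=> 0.
Proof. by apply/funext => x; exact: derive_cst. Qed.

Lemma ck_cst k (c : R) : ck k (fun=> c).
Proof.
elim: k c => [//|k IHk] c; split.
- by move=> *; exact: derivable_cst.
- by move=> _ x i j _; rewrite !partial_cst.
- by move=> i; rewrite partial_cst; exact: IHk.
Qed.

Lemma partialD f g i x : derivable f x (e i) -> derivable g x (e i) ->
  partial i (f \+ g) x = partial i f x + partial i g x.
Proof. exact: deriveD. Qed.

Lemma partialM f g i x : derivable f x (e i) -> derivable g x (e i) ->
  partial i (f \* g) x = partial i f x * g x + f x * partial i g x.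
Proof.
move=> df dg; transitivity (f x *: 'D_(e i) g x + g x *: 'D_(e i) f x).
  exact: (deriveM df dg).
by rewrite addrC; congr (_ + _); exact: mulrC.
Qed.

Lemma ckD k f g : ck k f -> ck k g -> ck k (f \+ g).
Proof.
elim: k f g => [//|k IHk] f g [df cf pf] [dg cg pg].
have pD i : {in V, partial i f \+ partial i g =1 partial i (f \+ g)}.
  by move=> x /[!inE] Vx; rewrite partialD; [|exact: df|exact: dg].
split.
- by move=> x i Vx; apply: derivableD; [exact: df|exact: dg].
- move=> k0 x i j Vx; have xV : x \in V by rewrite inE.
  have [k' kE] : exists k', k = k'.+1 by exists k.-1; rewrite prednK.
  subst k.
  have dpf l l' : derivable (partial l f) x (e l') by case: (pf l) => + _ _; exact.
  have dpg l l' : derivable (partial l g) x (e l') by case: (pg l) => + _ _; exact.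
  rewrite -!(partial_ext (pD _) _ xV).
  rewrite (partialD (dpf j i) (dpg j i)) (partialD (dpf i j) (dpg i j)).
  by rewrite (cf isT x i j Vx) (cg isT x i j Vx).
- move=> i; apply: ck_ext (pD i) _.
  by apply: IHk; [exact: pf|exact: pg].
Qed.

Lemma ckM k f g : ck k f -> ck k g -> ck k (f \* g).
Proof.
elim: k f g => [//|k IHk] f g ckf ckg; have [df cf pf] := ckf; have [dg cg pg] := ckg.
have pM i : {in V, (partial i f \* g) \+ (f \* partial i g) =1 partial i (f \* g)}.
  by move=> x /[!inE] Vx; rewrite partialM; [|exact: df|exact: dg].
split.
- by move=> x i Vx; apply: derivableM; [exact: df|exact: dg].
- move=> k0 x i j Vx; have xV : x \in V by rewrite inE.
  have [k' kE] : exists k', k = k'.+1 by exists k.-1; rewrite prednK.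
  subst k.
  have dpf l l' : derivable (partial l f) x (e l') by case: (pf l) => + _ _; exact.
  have dpg l l' : derivable (partial l g) x (e l') by case: (pg l) => + _ _; exact.
  have dfg l l' : derivable (partial l f \* g) x (e l').
    by apply: derivableM; [exact: dpf|exact: dg].
  have dgf l l' : derivable (f \* partial l g) x (e l').
    by apply: derivableM; [exact: df|exact: dpg].
  have main l l' : partial l (partial l' (f \* g)) x =
      partial l (partial l' f) x * g x + partial l' f x * partial l g x
      + (partial l f x * partial l' g x + f x * partial l (partial l' g) x).
    rewrite -(partial_ext (pM l') _ xV) (partialD (dfg l' l) (dgf l' l)).
    by rewrite (partialM (dpf l' l) (dg x l Vx)) (partialM (df x l Vx) (dpg l' l)).
  rewrite (main i j) (main j i) (cf isT x i j Vx) (cg isT x i j Vx).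
  by rewrite -[LHS]addrA -[RHS]addrA; congr (_ + _); exact: addrCA.
- move=> i; apply: ck_ext (pM i) _; apply: ckD; apply: IHk;
    [exact: pf|exact: ckS ckg|exact: ckS ckf|exact: pg].
Qed.

Lemma partialV f i x : f x != 0 -> derivable f x (e i) ->
  partial i (fun y => (f y)^-1) x = - ((f x)^-1 * (f x)^-1 * partial i f x).
Proof. by move=> fx df; rewrite /partial deriveV // -exprVn expr2 scaleNr. Qed.

(** The derivative - u^2 d_i f of u = 1/f involves only u and d_i f, so the induction on k closes
    through [ckM]. *)
Lemma ckV k f : (forall x, V x -> f x != 0) -> ck k f -> ck k (fun x => (f x)^-1).
Proof.
move=> f0; elim: k => [//|k IHk] ckf; have [df cf pf] := ckf.
set u := fun x => _.
have pV i : {in V, cst (-1) \* ((u \* u) \* partial i f) =1 partial i u}.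
  by move=> x /[!inE] Vx; rewrite partialV ?f0 /= ?mulN1r //; exact: df.
have du x i : V x -> derivable u x (e i).
  by move=> Vx; apply: derivableV; [exact: f0|exact: df].
split; first exact: du.
- move=> k0 x i j Vx; have xV : x \in V by rewrite inE.
  have [k' kE] : exists k', k = k'.+1 by exists k.-1; rewrite prednK.
  subst k.
  have dpf l l' : derivable (partial l f) x (e l') by case: (pf l) => + _ _; exact.
  have duu l : derivable (u \* u) x (e l) by apply: derivableM; exact: du.
  have dd l l' : derivable ((u \* u) \* partial l f) x (e l').
    exact: derivableM.
  have main l l' : partial l (partial l' u) x = - ((- (u x * u x * partial l f x) * u x
      + u x * - (u x * u x * partial l f x)) * partial l' f x
      + u x * u x * partial l (partial l' f) x).
    rewrite -(partial_ext (pV l') _ xV) (partialM (derivable_cst _ _ _) (dd l' l)).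
    rewrite partial_cst mul0r add0r mulN1r (partialM (duu l) (dpf l' l)).
    rewrite (partialM (du x l Vx) (du x l Vx)) partialV //; first exact: f0.
    exact: df.
  rewrite (main i j) (main j i) (cf isT x i j Vx).
  move: (partial j _ x) (partial i f x) (partial j f x) (u x) => a b c d; ring.
- move=> i; apply: ck_ext (pV i) _; apply: ckM; first exact: ck_cst.
  by apply: ckM (pf i); apply: ckM; exact: IHk (ckS ckf).
Qed.

End DirectionalClass.

(* The smooth functions on V, normalised to be constant off V: this makes them
   a ring with evaluation morphisms at every point, and two of them are equal
   as soon as they agree on V. *)
Section SmoothRing.
Context {R : realType} {m : nat}.
Variables (V : set 'rV[R]_m) (p0 : 'rV[R]_m).
Hypothesis V_open : open V.
Hypothesis Vp0 : V p0.

(** The value off V is f p0 and not 0, since extension by 0 would exclude the constant 1. *)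
Definition normalised (f : 'rV[R]_m -> R) : Prop :=
  cinfty V f /\ forall x, ~ V x -> f x = f p0.

Definition normalisedb : {pred 'rV[R]_m -> R} := fun f => `[< normalised f >].

Lemma normalised_subring : subring_closed normalisedb.
Proof.
split.
- by apply/asboolP; split=> // k; exact: ck_cst.
- move=> f g /asboolP[sf cf] /asboolP[sg cg]; apply/asboolP; split.
    move=> k; have -> : f - g = f \+ (cst (-1) \* g).
      by apply/funext => x /=; rewrite mulN1r.
    by apply: (ckD V_open) => //; apply: (ckM V_open) => //; exact: ck_cst.
  by move=> x Vx; rewrite /= (_ : (f - g) x = f x - g x) // cf // cg.
move=> f g /asboolP[sf cf] /asboolP[sg cg]; apply/asboolP; split.
  by move=> k; exact: ckM.
by move=> x Vx; rewrite (_ : (f * g) x = f x * g x) // cf // cg.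
Qed.

Definition extend (f : 'rV[R]_m -> R) : 'rV[R]_m -> R :=
  fun x => if pselect (V x) then f x else f p0.

Lemma extendE f x : V x -> extend f x = f x.
Proof. by rewrite /extend; case: pselect. Qed.

Lemma extend_in f : {in V, f =1 extend f}.
Proof. by move=> x /[!inE] Vx; rewrite extendE. Qed.

Lemma extend_normalised f : cinfty V f -> extend f \in normalisedb.
Proof.
move=> sf; apply/asboolP; split; first by move=> k; apply: (ck_ext V_open (@extend_in f)).
by move=> x Vx; rewrite [RHS]extendE // /extend; case: pselect.
Qed.

End SmoothRing.

Record openDomain (R : realType) (m : nat) := OpenDomain {
  odom :> set 'rV[R]_m;
  opt : 'rV[R]_m;
  odom_open : open odom;
  odom_opt : odom opt }.
Arguments odom_open {R m} o.
Arguments odom_opt {R m} o.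

Section SmoothFun.
Context {R : realType} {m : nat} (B : openDomain R m).
Local Notation V := (odom B).

Definition smooth_pred : {pred 'rV[R]_m -> R} := normalisedb B (opt B).

HB.instance Definition _ := GRing.isSubringClosed.Build _ smooth_pred
  (normalised_subring (opt B) (odom_open B)).

Record smoothFun := SmoothFun {
  sfun_val :> 'rV[R]_m -> R;
  sfunP : sfun_val \in smooth_pred }.

HB.instance Definition _ := [isSub for sfun_val].
HB.instance Definition _ := [Choice of smoothFun by <:].
HB.instance Definition _ := [SubChoice_isSubComNzRing of smoothFun by <:].

Definition toSmooth (f : 'rV[R]_m -> R) (sf : cinfty B f) : smoothFun :=
  SmoothFun (extend_normalised (odom_open B) (odom_opt B) sf).

Lemma sfun_cinfty (f : smoothFun) : cinfty B f.
Proof. by case: f => f /= /asboolP[]. Qed.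

Lemma toSmoothE f (sf : cinfty B f) x : V x -> toSmooth sf x = f x.
Proof. exact: extendE. Qed.

Lemma sfun_ext (f g : smoothFun) : (forall x, V x -> f x = g x) -> f = g.
Proof.
case: f g => [f fP] [g gP] /= fg; apply: val_inj => /=; apply/funext => x.
have [Vx|Vx] := pselect (V x); first exact: fg.
have /asboolP[_ fc] := fP; have /asboolP[_ gc] := gP.
by rewrite fc // gc // fg //; exact: odom_opt.
Qed.

Definition sfun_eval x : smoothFun -> R := fun f => f x.

Fact sfun_eval_additive x : zmod_morphism (sfun_eval x).
Proof. by []. Qed.

Fact sfun_eval_multiplicative x : monoid_morphism (sfun_eval x).
Proof. by []. Qed.

HB.instance Definition _ x :=
  GRing.isZmodMorphism.Build smoothFun R (sfun_eval x) (sfun_eval_additive x).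
HB.instance Definition _ x :=
  GRing.isMonoidMorphism.Build smoothFun R (sfun_eval x) (sfun_eval_multiplicative x).

Lemma cinfty_partial f i : cinfty B f -> cinfty B (partial i f).
Proof. by move=> sf k; case: (sf k.+1) => _ _; exact. Qed.

Definition sder i (f : smoothFun) : smoothFun :=
  toSmooth (cinfty_partial i (sfun_cinfty f)).

Lemma sderE i f x : V x -> sder i f x = partial i f x.
Proof. exact: toSmoothE. Qed.

Lemma sfun_derivable (f : smoothFun) x i : V x -> derivable f x (delta_mx 0 i).
Proof. by case: (sfun_cinfty f 1%N) => df _ _; exact: df. Qed.

Lemma sder_derivation i : derivation (sder i).
Proof.
split=> f g; apply: sfun_ext => x Vx.
  rewrite (_ : (sder i f + sder i g) x = sder i f x + sder i g x) // !sderE //.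
  by apply: partialD; exact: sfun_derivable.
rewrite (_ : (_ + _ : smoothFun) x = sder i f x * g x + f x * sder i g x) //.
by rewrite !sderE //; apply: partialM; exact: sfun_derivable.
Qed.

Lemma sderC i j f : sder i (sder j f) = sder j (sder i f).
Proof.
apply: sfun_ext => x Vx; have xV : x \in V by rewrite inE.
have sd l : {in V, sder l f =1 partial l f}.
  by move=> y /[!inE] Vy; exact: sderE.
have key l l' : sder l (sder l' f) x = partial l (partial l' f) x.
  rewrite (sderE l (sder l' f) Vx).
  exact: (partial_ext (odom_open B) l (sd l') xV).
rewrite (key i j) (key j i); have [_ cf _] := sfun_cinfty f 2%N.
exact: (cf isT x i j Vx).
Qed.

Lemma toSmoothD i f (sf : cinfty B f) x : V x ->
  sder i (toSmooth sf) x = partial i f x.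
Proof.
move=> Vx; have xV : x \in V by rewrite inE.
rewrite (sderE i _ Vx); apply: (partial_ext (odom_open B) i _ xV).
by move=> y /[!inE] Vy; exact: toSmoothE.
Qed.

Definition scst (c : R) : smoothFun := toSmooth (fun k => ck_cst B k c).

Lemma scstE c x : V x -> scst c x = c.
Proof. exact: toSmoothE. Qed.

Lemma sder_cst i c : sder i (scst c) = 0.
Proof. by apply: sfun_ext => x Vx; rewrite toSmoothD // partial_cst. Qed.

End SmoothFun.

(** * Coordinate formulas as evaluations of ring elements *)

Section Dictionary.
Context {R : realType} {N m : nat} (B : openDomain R N).
(** Two instances occur: phi = [slice t] on a chart image with the spatial derivations, for the
    tensors of g_t, and phi the identity of the slab with all 1 + n derivations, for the cylinder
    metric. *)
Variables (U : set 'rV[R]_m) (phi : 'rV[R]_m -> 'rV[R]_N).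
Variable d : 'I_m -> smoothFun B -> smoothFun B.
Hypothesis U_open : open U.
Hypothesis phiU : forall x, U x -> odom B (phi x).
Hypothesis dE : forall (a : smoothFun B) x i, U x ->
  partial i (fun y => a (phi y)) x = d i a (phi x).
Hypothesis dD : forall i, derivation (d i).

Local Notation A := (smoothFun B).
Local Notation ev x := (@sfun_eval R N B (phi x)).
Local Notation half := (scst B 2^-1).

Lemma partial_rep (f : 'rV[R]_m -> R) (a : A) :
  (forall x, U x -> f x = ev x a) ->
  forall i x, U x -> partial i f x = ev x (d i a).
Proof.
move=> fa i x Ux; rewrite /sfun_eval -dE //; apply: (partial_ext U_open).
  by move=> y /[!inE] Uy; exact: fa.
by rewrite inE.
Qed.

Variables (g : 'rV[R]_m -> 'M[R]_m) (G GI : 'M[A]_m).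
Hypothesis gE : forall x, U x -> g x = map_mx (ev x) G.
Hypothesis GT : G^T = G.
Hypothesis GK : G *m GI = 1%:M.

Lemma half2_scst : half + half = 1.
Proof.
apply: sfun_ext => x Vx; rewrite -[LHS]/(half x + half x) !scstE //.
by rewrite -[RHS]/(1 : R) [RHS](splitr 1) !mul1r.
Qed.

Lemma invmx_rep x : U x -> invmx (g x) = map_mx (ev x) GI.
Proof.
move=> Ux; have gK : g x *m map_mx (ev x) GI = 1%:M.
  by rewrite gE // -map_mxM GK map_mx1.
have [gu _] := mulmx1_unit gK.
by rewrite -[RHS]mul1mx -(mulVmx gu) -mulmxA gK mulmx1.
Qed.

Lemma christoffel_rep a i j x : U x ->
  christoffel g a i j x = ev x (Gamma d half G GI i a j).
Proof.
move=> Ux; rewrite GammaE rmorphM; congr (_ * _).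
  by apply/esym/scstE/phiU.
rewrite rmorph_sum; apply: eq_bigr => l _.
rewrite rmorphM rmorphB rmorphD invmx_rep // mxE; congr (_ * _).
have rep u v y : U y -> g y u v = ev y (G u v) by move=> Uy; rewrite gE // mxE.
by rewrite !(partial_rep (rep _ _)).
Qed.

Lemma ricci_rep x : U x -> ricci g x = map_mx (ev x) (Ric d half G GI).
Proof.
move=> Ux; apply/matrixP => i j; rewrite [RHS]mxE RicE [LHS]mxE rmorphD !rmorph_sum.
have rep u v w y : U y -> christoffel g u v w y = ev y (Gamma d half G GI v u w).
  exact: christoffel_rep.
have repC u v w y : U y -> christoffel g u v w y = ev y (Gamma d half G GI w u v).
  by move=> Uy; rewrite -(GammaC d half GI GT v u w); exact: rep.
congr (_ + _); apply: eq_bigr => a _.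
  by rewrite rmorphB (partial_rep (repC a i j)) // (partial_rep (repC a i a)).
rewrite rmorph_sum; apply: eq_bigr => b _.
rewrite rmorphB; congr (_ - _); rewrite rmorphM; congr (_ * _);
  by [exact: rep|exact: repC].
Qed.

Section Tensor.
Variables (h : 'rV[R]_m -> 'M[R]_m) (H : 'M[A]_m).
Hypothesis hE : forall x, U x -> h x = map_mx (ev x) H.

Lemma trg_rep x : U x -> trg g h x = ev x (\tr (GI *m H)).
Proof.
by move=> Ux; rewrite /trg invmx_rep // hE // -map_mxM trace_map_mx.
Qed.

Lemma dotm_rep x : U x -> dotm g h h x = ev x (\tr ((GI *m H) *m (GI *m H))
  - \tr (GI *m H) * \tr (GI *m H)).
Proof.
move=> Ux; rewrite /dotm trg_rep // invmx_rep // hE // -!map_mxM trace_map_mx.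
by rewrite rmorphB rmorphM -mulmxA.
Qed.

Lemma divm_rep j x : U x -> divm g h x 0 j =
  ev x (d j (\tr (GI *m H)) - divX d half G GI (GI *m H) j).
Proof.
move=> Ux; rewrite mxE [X in _ + X]mxE [X in X + _]mxE addrC rmorphB.
rewrite (partial_rep trg_rep) //; congr (_ - _).
rewrite (divX_cov dD half2_scst GT GK) rmorph_sum; apply: eq_bigr => i _.
rewrite mxE rmorph_sum; apply: eq_bigr => a _.
rewrite rmorphM invmx_rep // mxE; congr (_ * _).
have rep u v y : U y -> h y u v = ev y (H u v) by move=> Uy; rewrite hE // mxE.
rewrite /nabla (partial_rep (rep a j) i Ux) !(addmxE, oppmxE) -addrA -opprD rmorphB.
congr (_ - _); first by rewrite [in RHS]mxE.
rewrite big_split rmorphD; congr (_ + _); rewrite mxE rmorph_sum;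
  apply: eq_bigr => l _; rewrite rmorphM.
  by rewrite mxE; congr (_ * _); [exact: christoffel_rep|exact: rep].
by rewrite mulrC; congr (_ * _); [exact: rep|exact: christoffel_rep].
Qed.

End Tensor.

Lemma scal_rep x : U x -> scal g x = ev x (Scal d half G GI).
Proof. exact: (trg_rep ricci_rep). Qed.

End Dictionary.

(** * Symmetry of second derivatives *)

Section DifferenceQuotients.
Context {R : realType} {V W : normedModType R}.
Variables (f : V -> R) (g : W -> R) (a v : V) (b w : W).
Hypothesis fg : forall h : R, f (h *: v + a) = g (h *: w + b).

Let quotE : (fun h : R => h^-1 *: ((f \o shift a) (h *: v) - f a)) =
  (fun h : R => h^-1 *: ((g \o shift b) (h *: w) - g b)).
Proof.
by apply/funext => h /=; rewrite fg -[f a]/(f a) -[a]add0r -(scale0r v) fg scale0r add0r.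
Qed.

(** A directional derivative sees only the restriction to a line. This moves derivatives between
    functions on the slab, their slices, and functions of t alone. *)
Lemma derive_quot : 'D_v f a = 'D_w g b.
Proof. by rewrite /derive quotE. Qed.

Lemma derivable_quot : derivable g b w -> derivable f a v.
Proof. by rewrite /derivable quotE. Qed.

End DifferenceQuotients.

Section Schwarz.
Context {R : realType} {n : nat}.
Implicit Types (f : 'rV[R]_n -> R) (U : set 'rV[R]_n).

Local Notation e i := (delta_mx (0 : 'I_1) i).

Lemma derivable_subf f1 f2 x v : derivable f1 x v -> derivable f2 x v ->
  derivable (fun y => f1 y - f2 y) x v.
Proof. exact: derivableB. Qed.

Lemma partial_subf f1 f2 x i : derivable f1 x (e i) -> derivable f2 x (e i) ->
  partial i (fun y => f1 y - f2 y) x = partial i f1 x - partial i f2 x.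
Proof. exact: deriveB. Qed.

Lemma derivable_mulf (a : R) f x v : derivable f x v ->
  derivable (fun y => a * f y) x v.
Proof. exact: derivableZ. Qed.

Lemma partial_mulf (a : R) f x i : derivable f x (e i) ->
  partial i (fun y => a * f y) x = a * partial i f x.
Proof. exact: deriveZ. Qed.

Lemma line_is_derive f (y : 'rV[R]_n) i s : derivable f (s *: e i + y) (e i) ->
  is_derive s 1 (fun r : R => f (r *: e i + y)) (partial i f (s *: e i + y)).
Proof.
move=> df.
have quot h : f ((h *: 1 + s) *: e i + y) = f (h *: e i + (s *: e i + y)).
  by rewrite scalerDl addrA [h *: 1]mulr1.
apply: DeriveDef; last exact: (derive_quot quot).
exact: (@derivable_quot _ _ _ (fun r : R => f (r *: e i + y)) _ _ _ _ _ quot).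
Qed.

Lemma line_MVT f (y : 'rV[R]_n) i (k : R) : 0 <= k ->
  (forall s, s \in `[0, k] -> derivable f (s *: e i + y) (e i)) ->
  exists2 c, c \in `[0, k] &
    f (k *: e i + y) - f y = partial i f (c *: e i + y) * k.
Proof.
move=> k0 df.
have der s : s \in `]0, k[ -> is_derive s 1 (fun r : R => f (r *: e i + y))
    (partial i f (s *: e i + y)).
  by move=> s0k; apply/line_is_derive/df/subset_itv_oo_cc.
have cont : {within `[0, k], continuous (fun r : R => f (r *: e i + y))}.
  apply: derivable_within_continuous => s s0k.
  by case: (line_is_derive (df s s0k)).
have [c c0k eqc] := MVT_segment k0 der cont.
exists c => //; move: eqc; rewrite scale0r add0r subr0; exact.
Qed.

Lemma smooth_on_partials U f s : smooth_on U f -> smooth_on U (partials s f).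
Proof.
move=> sf s' x Ux; rewrite /partials -foldr_cat; exact: (sf (s' ++ s) x Ux).
Qed.

(** The mean value theorem is applied to the increment F of f along e_j, in direction e_i, and then
    to the partial derivative of f along e_i, in direction e_j. *)
Lemma second_difference U f x i j (k : R) : smooth_on U f -> 0 < k ->
  (forall s t, s \in `[0, k] -> t \in `[0, k] -> U (t *: e j + (s *: e i + x))) ->
  exists s t, [/\ s \in `[0, k], t \in `[0, k] &
    f (k *: e j + (k *: e i + x)) - f (k *: e i + x) - (f (k *: e j + x) - f x)
    = partial j (partial i f) (t *: e j + (s *: e i + x)) * k * k].
Proof.
move=> sf k0 boxU; have k_ge0 := ltW k0.
have kI : k \in `[0, k] by rewrite in_itv /= k_ge0 lexx.
have zI : 0 \in `[0, k] by rewrite in_itv /= lexx k_ge0.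
pose F y := f (k *: e j + y) - f y.
have shiftD y : derivable f (k *: e j + y) (e i) ->
    derivable (fun z => f (k *: e j + z)) y (e i) /\
    partial i (fun z => f (k *: e j + z)) y = partial i f (k *: e j + y).
  move=> dfy; have quot h : f (k *: e j + (h *: e i + y)) = f (h *: e i + (k *: e j + y)).
    by rewrite addrCA.
  split; last exact: (derive_quot quot).
  exact: (@derivable_quot _ _ _ (fun z => f (k *: e j + z)) _ _ _ _ _ quot).
have dF s : s \in `[0, k] -> derivable F (s *: e i + x) (e i) /\
    partial i F (s *: e i + x) =
    partial i f (k *: e j + (s *: e i + x)) - partial i f (s *: e i + x).
  move=> sI; have [_ /(_ i) d1] := sf [::] _ (boxU s k sI kI).
  have [_ /(_ i)] := sf [::] _ (boxU s 0 sI zI); rewrite scale0r add0r => d2.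
  have [d3 e3] := shiftD _ d1; split; first exact: derivable_subf d3 d2.
  by rewrite (partial_subf d3 d2) e3.
have [s sI eqs] := @line_MVT F x i k k_ge0 (fun s sI => (dF s sI).1).
have [|t tI eqt] := @line_MVT (partial i f) (s *: e i + x) j k k_ge0.
  by move=> t tI; have [_ /(_ j)] := sf [:: i] _ (boxU s t sI tI).
exists s, t; split => //.
by rewrite -eqt -(dF s sI).2 -eqs.
Qed.

Lemma norm_delta_le1 (i : 'I_n) : `|e i : 'rV[R]_n| <= 1.
Proof.
rewrite /Num.norm /= mx_normrE; apply: bigmax_le => // -[u v] _ /=.
by rewrite mxE; case: (_ && _); rewrite ?normr1 ?normr0.
Qed.

(** The second difference is symmetric in i and j, so both mixed derivatives take a common value at
    suitable points of a small box; both are continuous at x. *)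
Lemma schwarz U f x i j : open U -> smooth_on U f -> U x ->
  partial i (partial j f) x = partial j (partial i f) x.
Proof.
move=> oU sf Ux; apply/eqP; rewrite -subr_eq0 -normr_le0; apply/ler_addgt0Pl => eps eps0.
have eps2 : 0 < eps / 2 by rewrite divr_gt0.
have cP := (sf [:: i; j] x Ux).1; have cQ := (sf [:: j; i] x Ux).1.
pose P := partial i (partial j f); pose Q := partial j (partial i f).
have nP : nbhs x [set y | `|P x - P y| < eps / 2].
  by move/cvgrPdist_lt: cP => /(_ _ eps2).
have nQ : nbhs x [set y | `|Q x - Q y| < eps / 2].
  by move/cvgrPdist_lt: cQ => /(_ _ eps2).
have nU : nbhs x U := open_nbhs_nbhs (conj oU Ux).
have := filterI nU (filterI nP nQ); rewrite nbhs_ballP => -[r /= r0 rball].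
(* The points of the box are within 2k of x, which must stay below r. *)
pose k := r / 3; have k0 : 0 < k by rewrite divr_gt0.
have inball u v s t : s \in `[0, k] -> t \in `[0, k] ->
    ball x r (t *: e u + (s *: e v + x)).
  rewrite !in_itv /= => /andP[s0 sk] /andP[t0 tk].
  rewrite -ball_normE /= distrC addrA addrK.
  apply: (@le_lt_trans _ _ (t + s)); last first.
    by apply: (@le_lt_trans _ _ (k + k)); [exact: lerD|rewrite /k; lra].
  apply: le_trans (ler_normD _ _) _; rewrite !normrZ (ger0_norm t0) (ger0_norm s0).
  by apply: lerD; apply: ler_piMr => //; exact: norm_delta_le1.
have [s [t [sI tI eq1]]] := @second_difference U f x i j k sf k0
  (fun s t sI tI => (rball _ (inball j i s t sI tI)).1).
have [s' [t' [sI' tI' eq2]]] := @second_difference U f x j i k sf k0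
  (fun s t sI tI => (rball _ (inball i j s t sI tI)).1).
have kk : k * k != 0 by rewrite mulf_neq0 // gt_eqF.
have eq12 : partial j (partial i f) (t *: e j + (s *: e i + x)) =
    partial i (partial j f) (t' *: e i + (s' *: e j + x)).
  have swap (a1 a2 a3 a4 : R) : a1 - a2 - (a3 - a4) = a1 - a3 - (a2 - a4) by ring.
  apply: (mulIf kk); rewrite [LHS]mulrA [RHS]mulrA.
  apply: etrans (esym eq1) _; apply: etrans eq2.
  by rewrite swap (addrCA (k *: e j)).
have [_ [/= bP _]] := rball _ (inball i j s' t' sI' tI').
have [_ [_ /= bQ]] := rball _ (inball j i s t sI tI).
rewrite addr0.
have -> : partial i (partial j f) x - partial j (partial i f) x =
  (P x - P (t' *: e i + (s' *: e j + x)))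
  - (Q x - Q (t *: e j + (s *: e i + x))).
  by rewrite [Q (_ + _)]eq12 opprB addrA subrK.
rewrite [eps]splitr; apply: le_trans (ler_normB _ _) _.
exact: (lerD (ltW bP) (ltW bQ)).
Qed.

(** The combination is that of [frechet_deriv]: a difference quotient, with a = 1/e, minus the
    expected derivative. *)
Lemma partials_lincomb U (f1 f2 f3 : 'rV[R]_n -> R) (a : R) s : open U ->
  smooth_on U f1 -> smooth_on U f2 -> smooth_on U f3 ->
  {in U, partials s (fun y => a * (f1 y - f2 y) - f3 y) =1
    fun y => a * (partials s f1 y - partials s f2 y) - partials s f3 y}.
Proof.
move=> oU s1 s2 s3; elim: s => [//|i s IHs] x xV.
rewrite [LHS](partial_ext oU i IHs xV); move: xV; rewrite inE => Ux.
have d1 := (s1 s x Ux).2 i; have d2 := (s2 s x Ux).2 i; have d3 := (s3 s x Ux).2 i.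
have d12 := derivable_subf d1 d2.
by rewrite (partial_subf (@derivable_mulf a _ _ _ d12) d3)
  (@partial_mulf a _ _ _ d12) (partial_subf d1 d2).
Qed.

End Schwarz.

(** * Smooth curves of metrics in a chart *)

Section Slab.
Context {R : realType} {n : nat}.
Implicit Types (I : set R) (U : set 'rV[R]_n) (y : 'rV[R]_(1 + n)).

Local Notation time y := (lsubmx y 0 0).
Local Notation e i := (delta_mx (0 : 'I_1) i).
Local Notation o := (lshift n (ord0 : 'I_1)).

Definition slab I U : set 'rV[R]_(1 + n) :=
  [set y | I (lsubmx y 0 0) /\ U (rsubmx y)].

Definition slice (t : R) (x : 'rV[R]_n) : 'rV[R]_(1 + n) :=
  row_mx (const_mx t) x.

Lemma slice_time t x : time (slice t x) = t.
Proof. by rewrite row_mxKl mxE. Qed.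

Lemma slice_space t x : rsubmx (slice t x) = x.
Proof. exact: row_mxKr. Qed.

Lemma sliceK y : slice (time y) (rsubmx y) = y.
Proof.
rewrite -[RHS]hsubmxK; congr row_mx.
by apply/rowP => k; rewrite mxE !ord1.
Qed.

Lemma slab_slice I U t x : I t -> U x -> slab I U (slice t x).
Proof. by move=> It Ux; split; rewrite ?slice_time ?slice_space. Qed.

Lemma slab_open I U : open I -> open U -> open (slab I U).
Proof.
move=> oI oU; apply: openI.
  apply: (@open_comp _ _ (fun y => time y) I) => // y _.
  apply: (@continuous_comp _ _ _ lsubmx (fun M : 'M[R]_(1, 1) => M 0 0)).
    exact: continuous_lsubmx.
  exact: coord_continuous.
by apply: (@open_comp _ _ rsubmx U) => // y _; exact: continuous_rsubmx.
Qed.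

Lemma time_shift_o (h : R) y : time (h *: e o + y) = h + time y.
Proof. by rewrite !mxE !eqxx mulr1. Qed.

Lemma space_shift_o (h : R) y : rsubmx (h *: e o + y) = rsubmx y.
Proof. by apply/rowP => k; rewrite !mxE eq_rlshift mulr0 add0r. Qed.

Lemma time_shift_r (h : R) i y : time (h *: e (rshift 1 i) + y) = time y.
Proof. by rewrite !mxE eq_lrshift mulr0 add0r. Qed.

Lemma space_shift_r (h : R) i y :
  rsubmx (h *: e (rshift 1 i) + y) = h *: e i + rsubmx y.
Proof. by apply/rowP => k; rewrite !mxE eq_rshift. Qed.

Lemma slice_shift_r (h : R) i t x :
  slice t (h *: e i + x) = h *: e (rshift 1 i) + slice t x.
Proof.
by rewrite -[RHS]sliceK time_shift_r space_shift_r slice_time slice_space.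
Qed.

Lemma slice_shift_o (h : R) t x :
  slice (h + t) x = h *: e o + slice t x.
Proof.
by rewrite -[RHS]sliceK time_shift_o space_shift_o slice_time slice_space.
Qed.

End Slab.

(** * Jets of a curve of tensor fields as functions on the slab *)

Section Generators.
Context {R : realType} {n : nat} (M : chartedSpace R n) (c : chart M).
Variables (I : set R) (H : nat -> R -> tfield M).
Local Notation U := (chart_image c).
Hypothesis I_open : open I.
Hypothesis U_open : open U.
Hypothesis HP : forall m t, I t ->
  sym2_field (H m t) /\ frechet_deriv (H m) t (H m.+1 t).

Local Notation time y := (lsubmx y 0 0).
Local Notation e i := (delta_mx (0 : 'I_1) i).
Local Notation o := (lshift n (ord0 : 'I_1)).
Local Notation V := (slab I U).

Lemma curve_smooth_on m t i j : I t -> smooth_on U (fun x => H m t c x i j).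
Proof. by case/(HP m) => -[+ _ _] _; exact. Qed.

(** Convergence in the seminorm of [s] over the compact set {x}. As the seminorms contain the
    spatial partial derivatives, these commute with d/dt at once. *)
Lemma curve_time_derivative m s i j t x : I t -> U x ->
  is_derive t 1 (fun r : R => partials s (fun z => H m r c z i j) x)
    (partials s (fun z => H m.+1 t c z i j) x).
Proof.
move=> It Ux; set G := fun r : R => _; set l := partials s _ x.
suff cv : (fun h : R => h^-1 *: ((G \o shift t) (h *: 1) - G t)) @ 0^' --> l.
  by apply: DeriveDef; [exact: cvgP cv|exact: cvg_lim cv].
apply/cvgrPdist_lt => eps eps0.
have [_ /(_ c [set x] s i j)] := HP m It.
have K : [set x] `<=` U by move=> _ ->.
move=> /(_ (@compact_set1 _ x) K eps eps0) fd.
have nI : \forall h \near (0 : R)^', I (t + h).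
  apply: nbhs_dnbhs; have /nbhs0P : nbhs t I := open_nbhs_nbhs (conj I_open It).
  by apply: filterS => h /=.
apply: filterS2 nI fd => h Ith /(_ x erefl) lth.
rewrite distrC; apply: le_lt_trans lth; rewrite le_eqVlt; apply/orP; left; apply/eqP.
have xU : x \in U by rewrite inE.
rewrite (partials_lincomb _ s U_open (curve_smooth_on m i j Ith)
  (curve_smooth_on m i j It) (curve_smooth_on m.+1 i j It) xU).
by rewrite /= [h *: 1]mulr1 (addrC h).
Qed.

(** A family stable under all coordinate derivatives: a spatial one prepends an index to [s], the
    time one raises [m]. *)
Definition jet m (s : seq 'I_n) i j : 'rV[R]_(1 + n) -> R :=
  fun y => partials s (fun x => H m (time y) c x i j) (rsubmx y).

Lemma jet_derivable_r m s i j l y : V y ->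
  derivable (jet m s i j) y (e (rshift 1 l)).
Proof.
move=> [It Ux]; have [_ /(_ l) d] := curve_smooth_on m i j It s Ux.
apply: (derivable_quot _ d) => h.
by rewrite /jet time_shift_r space_shift_r.
Qed.

Lemma jet_partial_r m s i j l :
  partial (rshift 1 l) (jet m s i j) = jet m (l :: s) i j.
Proof.
apply/funext => y; apply: derive_quot => h.
by rewrite /jet time_shift_r space_shift_r.
Qed.

Let jet_quot_o m s i j y (h : R) : jet m s i j (h *: e o + y) =
  (fun r : R => partials s (fun z => H m r c z i j) (rsubmx y)) (h *: 1 + time y).
Proof. by rewrite /jet time_shift_o space_shift_o [h *: 1]mulr1. Qed.

Lemma jet_derivable_o m s i j y : V y -> derivable (jet m s i j) y (e o).
Proof.
move=> [It Ux]; have [d _] := curve_time_derivative m s i j It Ux.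
exact: (derivable_quot (jet_quot_o m s i j y) d).
Qed.

Lemma jet_partial_o m s i j y : V y ->
  partial o (jet m s i j) y = jet m.+1 s i j y.
Proof.
move=> [It Ux]; have [_ dv] := curve_time_derivative m s i j It Ux.
exact: etrans (derive_quot (jet_quot_o m s i j y)) dv.
Qed.

Lemma ord_cylP (p : 'I_(1 + n)) : p = o \/ exists l, p = rshift 1 l.
Proof.
case: (splitP p) => [k|k] pk; [left|right; exists k]; apply: val_inj => //=.
by rewrite pk (ord1 k).
Qed.

(** A time and a spatial derivative commute because either order leads to the same jet; Schwarz's
    theorem is called for two spatial directions. *)
Lemma jet_cinfty m s i j : cinfty V (jet m s i j).
Proof.
have oV : open V by exact: slab_open.
move=> k; elim: k m s => [//|k IHk] m s.
have eqo m' s' : {in V, jet m'.+1 s' i j =1 partial o (jet m' s' i j)}.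
  by move=> y /[!inE] Vy; rewrite jet_partial_o.
split.
- move=> y p Vy; case: (ord_cylP p) => [->|[l ->]].
    exact: jet_derivable_o.
  exact: jet_derivable_r.
- move=> _ y p q Vy; have yV : y \in V by rewrite inE.
  case: (ord_cylP p) => [->|[l ->]]; case: (ord_cylP q) => [->|[l' ->]].
  + by [].
  + rewrite jet_partial_r jet_partial_o // -(partial_ext oV _ (eqo m s) yV).
    by rewrite jet_partial_r.
  + rewrite jet_partial_r jet_partial_o // -(partial_ext oV _ (eqo m s) yV).
    by rewrite jet_partial_r.
  + rewrite !jet_partial_r; case: Vy => It Ux.
    by apply: (schwarz l l' U_open _ Ux); apply: smooth_on_partials; exact: curve_smooth_on.
- move=> p; case: (ord_cylP p) => [->|[l ->]].
    exact: (ck_ext oV (eqo m s) (IHk _ _)).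
  by rewrite jet_partial_r; exact: IHk.
Qed.

End Generators.

(** * A solution of the evolution equation in one chart *)

Section LocalSolution.
Context {R : realType} {n : nat} (M : chartedSpace R n) (c : chart M).
Variables (I : set R) (H : nat -> R -> tfield M) (alpha lambda : R).
Local Notation U := (chart_image c).
Hypothesis n_ge2 : (2 <= n)%N.
Hypothesis alpha_neq0 : alpha != 0.
Hypothesis I_open : open I.
Hypothesis I_itv : is_interval I.
Hypothesis U_open : open U.
Hypothesis HP : forall m t, I t ->
  sym2_field (H m t) /\ frechet_deriv (H m) t (H m.+1 t).
Hypothesis det_neq0 : forall t x, I t -> U x -> \det (H 0%N t c x) != 0.
Hypothesis evolution : forall t x, I t -> U x ->
  dt (dt (H 0%N)) t c x = christoffelm (H 0%N t c) (dt (H 0%N) t c) x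
    - (2 * alpha) *: gradm lambda (H 0%N t c) x.

Local Notation time y := (lsubmx y 0 0).
Local Notation e i := (delta_mx (0 : 'I_1) i).
Local Notation o := (lshift n (ord0 : 'I_1)).
Local Notation V := (slab I U).

Lemma dt_curve m t x : I t -> U x -> dt (H m) t c x = H m.+1 t c x.
Proof.
move=> It Ux.
have der i j := curve_time_derivative I_open U_open HP m [::] i j It Ux.
rewrite /dt derive1E derive_mx; last first.
  by apply/derivable_mxP => i j; case: (der i j).
by apply/matrixP => i j; rewrite mxE; case: (der i j).
Qed.

Lemma dt_dt_curve t x : I t -> U x -> dt (dt (H 0%N)) t c x = H 2%N t c x.
Proof.
move=> It Ux; rewrite -dt_curve // /dt !derive1E; apply: near_eq_derive.
have : nbhs t I := open_nbhs_nbhs (conj I_open It).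
by apply: filterS => s Is; exact: dt_curve.
Qed.

Variable p : 'rV[R]_(1 + n).
Hypothesis Vp : V p.

Let B := OpenDomain (slab_open I_open U_open) Vp.
Local Notation A := (smoothFun B).
Let D (q : 'I_(1 + n)) : A -> A := sder q.
Let d (i : 'I_n) : A -> A := D (rshift 1 i).
Let del : A -> A := D o.
Local Notation half := (scst B 2^-1).
Local Notation ev y := (@sfun_eval R (1 + n) B y).

Let Hm m : 'M[A]_n :=
  \matrix_(i, j) (toSmooth (B := B) (jet_cinfty I_open U_open HP m [::] i j)).
Local Notation G := (Hm 0).

Lemma HmE m y : V y -> map_mx (ev y) (Hm m) = H m (time y) c (rsubmx y).
Proof.
move=> Vy; apply/matrixP => i j; rewrite [LHS]mxE [Hm _ _ _]mxE.
exact: (@toSmoothE _ _ B _ (jet_cinfty I_open U_open HP m [::] i j) _ Vy).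
Qed.

Lemma HmE_slice m t x : I t -> U x -> map_mx (ev (slice t x)) (Hm m) = H m t c x.
Proof.
by move=> It Ux; rewrite HmE ?slice_time ?slice_space //; exact: slab_slice.
Qed.

Lemma mx_ext u v (X Y : 'M[A]_(u, v)) :
  (forall y, V y -> map_mx (ev y) X = map_mx (ev y) Y) -> X = Y.
Proof.
move=> XY; apply/matrixP => i j; apply: sfun_ext => y Vy.
by have /matrixP/(_ i j) := XY y Vy; rewrite !mxE.
Qed.

Lemma del_Hm m : map_mx del (Hm m) = Hm m.+1.
Proof.
apply/matrixP => i j; rewrite [LHS]mxE [Hm _ _ _]mxE [Hm m.+1 _ _]mxE.
apply: sfun_ext => y Vy; rewrite [LHS](toSmoothD _ _ Vy) [RHS](toSmoothE _ Vy).
exact: (jet_partial_o I_open U_open HP).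
Qed.

Lemma HmT m : (Hm m)^T = Hm m.
Proof.
apply: mx_ext => y Vy; have [It Ux] := Vy; rewrite -map_trmx HmE //.
by have [[_ sy _] _] := HP m It; exact: sy.
Qed.

Lemma detG_neq0 y : V y -> (\det G : A) y != 0.
Proof.
move=> Vy; rewrite -[(\det G : A) y]/(ev y (\det G)) -det_map_mx HmE //.
by case: Vy; exact: det_neq0.
Qed.

(** The inverse metric is formed inside the ring by Cramer's rule, from the pointwise inverse of det
    g. *)
Let idet : A := toSmooth (B := B)
  (fun k => ckV (slab_open I_open U_open) detG_neq0 (sfun_cinfty (\det G : A) k)).

Let GI : 'M[A]_n := idet *: \adj G.

Lemma GK : G *m GI = 1%:M.
Proof.
rewrite /GI -scalemxAr mul_mx_adj scale_scalar_mx; congr (_%:M).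
apply: sfun_ext => y Vy; rewrite -[LHS]/(idet y * (\det G : A) y).
by rewrite [idet y](toSmoothE _ Vy) mulVf // detG_neq0.
Qed.

Let phiU t : I t -> forall x, U x -> odom B (slice t x).
Proof. by move=> It x Ux; exact: slab_slice. Qed.

Let dE t : I t -> forall (a : A) x i, U x ->
  partial i (fun y => a (slice t y)) x = d i a (slice t x).
Proof.
move=> It a x i Ux; rewrite /d /D sderE; last exact: slab_slice.
by apply: derive_quot => h; rewrite slice_shift_r.
Qed.

Let dD i : derivation (d i). Proof. exact: sder_derivation. Qed.

Let gE t : I t -> forall x, U x -> H 0%N t c x = map_mx (ev (slice t x)) G.
Proof. by move=> It x Ux; rewrite HmE_slice. Qed.

Let hE t : I t -> forall x, U x ->
  dt (H 0%N) t c x = map_mx (ev (slice t x)) (Hm 1).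
Proof. by move=> It x Ux; rewrite HmE_slice // dt_curve. Qed.

Local Notation mom := (momentum d half G GI del).
Local Notation K := (shape_op G GI del).
Local Notation th := (expansion G GI del).
Let al := scst B alpha.
Let l := scst B lambda.
Let nu := scst B (4 * (n%:R - 1))^-1.
Let k := al * l * (n%:R - 1).
Local Notation en := (energy d half G GI del (al + al) k).
Local Notation N := (\tr (K *m K) - th * th).

Lemma momentum_rep t x j : I t -> U x ->
  divm (H 0%N t c) (dt (H 0%N) t c) x 0 j = ev (slice t x) (mom j).
Proof.
move=> It Ux; rewrite /momentum /expansion /shape_op del_Hm.
exact: (divm_rep U_open (phiU It) (dE It) dD (gE It) (HmT 0) GK (hE It)).
Qed.

Lemma n1_neq0 : n%:R - 1 != 0 :> R.
Proof. by rewrite subr_eq0 (eqr_nat R n 1) gtn_eqF. Qed.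

Lemma scst_eval r y : V y -> (ev y : {rmorphism A -> R}) (scst B r) = r.
Proof. exact: (@scstE _ _ B r y). Qed.

Let al_eval y (Vy : V y) : (ev y : {rmorphism A -> R}) al = alpha := scst_eval alpha Vy.
Let l_eval y (Vy : V y) : (ev y : {rmorphism A -> R}) l = lambda := scst_eval lambda Vy.
Let nu_eval y (Vy : V y) : (ev y : {rmorphism A -> R}) nu = (4 * (n%:R - 1))^-1 :=
  scst_eval _ Vy.

Lemma energy_rep t x : I t -> U x ->
  hamiltonian alpha lambda (H 0%N t c) (dt (H 0%N) t c) x = ev (slice t x) en.
Proof.
move=> It Ux; have Vy := slab_slice It Ux.
rewrite /energy /expansion /shape_op del_Hm /hamiltonian /scal_shift.
rewrite (dotm_rep (gE It) GK (hE It)) //.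
rewrite (scal_rep U_open (phiU It) (dE It) (gE It) (HmT 0) GK) //.
have ek : (ev (slice t x) : {rmorphism A -> R}) k = alpha * lambda * (n%:R - 1).
  by rewrite /k !rmorphM rmorphB rmorph_nat rmorph1 al_eval // l_eval.
move: (\tr _ - _) (Scal _ _ _ _) => X S.
rewrite rmorphB rmorphD (rmorphM _ half) (rmorphM _ (al + al)) (rmorphD _ al)
  (rmorphD _ k) ek al_eval // scst_eval //; ring.
Qed.

Lemma nuE : nu * (n%:R - 1) = half * half.
Proof.
apply: sfun_ext => y Vy; rewrite -[LHS]/(ev y (nu * (n%:R - 1))) -[RHS]/(ev y (half * half)).
rewrite !rmorphM rmorphB rmorph_nat rmorph1 nu_eval // scst_eval //.
by have n1 := n1_neq0; field.
Qed.

Lemma evolution_rep : map_mx del (map_mx del G) =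
  map_mx del G *m K - (half * th) *: map_mx del G - (nu * N) *: G
  - (al + al) *: (- Ric d half G GI + ((nu + nu) * Scal d half G GI) *: G + (half * l) *: G).
Proof.
apply: mx_ext => y Vy; have [It Ux] := Vy; rewrite -(sliceK y).
move: (time y) (rsubmx y) It Ux => t x It Ux {y Vy}.
have Vy := slab_slice It Ux.
rewrite /expansion /shape_op !del_Hm HmE_slice // -dt_dt_curve // evolution //.
rewrite /christoffelm /gradm (ricci_rep U_open (phiU It) (dE It) (gE It) (HmT 0) GK) //.
rewrite (scal_rep U_open (phiU It) (dE It) (gE It) (HmT 0) GK) //.
rewrite (dotm_rep (gE It) GK (hE It)) // (trg_rep (gE It) GK (hE It)) //.
rewrite (invmx_rep (gE It) GK) // hE // gE //.
move: (Scal _ _ _ _) (Ric _ _ _ _) (\tr (GI *m _)) (\tr (_ *m (GI *m _)) - _) => S Rc T X.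
move: (GI) => gi; rewrite !(map_mxB, map_mxD, map_mxN, map_mxM, map_mxZ).
rewrite !rmorphM !rmorphD al_eval // l_eval // nu_eval // scst_eval //.
have -> : alpha + alpha = 2 * alpha by ring.
have -> : (4 * (n%:R - 1))^-1 + (4 * (n%:R - 1))^-1 = (2 * (n%:R - 1))^-1 :> R.
  by have n1 := n1_neq0; field.
by rewrite (mulrC 2^-1 lambda) -mulmxA.
Qed.

Let dC i j (a : A) : D i (D j a) = D j (D i a). Proof. exact: sderC. Qed.
Let DD i : derivation (D i). Proof. exact: sder_derivation. Qed.
Let h2 : half + half = 1. Proof. exact: half2_scst. Qed.
Let Dal i : D i al = 0. Proof. exact: sder_cst. Qed.
Let Dl i : D i l = 0. Proof. exact: sder_cst. Qed.
Let ali := scst B alpha^-1.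
Let alK : al * ali = 1.
Proof.
apply: sfun_ext => y Vy; rewrite -[LHS]/((ev y : {rmorphism A -> R}) (al * ali)) rmorphM.
by rewrite al_eval // scst_eval // mulfV.
Qed.

(** I is an interval, so the segment between s and t stays in the domain and the mean value theorem
    applies on it. *)
Lemma slice_constant (a : A) s t x : I s -> I t -> U x -> del a = 0 ->
  a (slice s x) = 0 -> a (slice t x) = 0.
Proof.
move=> Is It Ux da as0.
have der r : I r -> is_derive r 1 (fun r : R => a (slice r x)) 0.
  move=> Ir; have Vr := slab_slice Ir Ux.
  have quot (u : R) : a (slice (u *: 1 + r) x) = a (u *: e o + slice r x).
    by rewrite [u *: 1]mulr1 slice_shift_o.
  apply: DeriveDef.
    apply: (@derivable_quot _ _ _ (fun r : R => a (slice r x)) a r 1 _ _ quot).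
    exact: (@sfun_derivable _ _ B a _ o Vr).
  apply: etrans (@derive_quot _ _ _ (fun r : R => a (slice r x)) a r 1 _ _ quot) _.
  apply: etrans (esym (@sderE _ _ B o a _ Vr)) _.
  by rewrite -[sder o a]/(del a) da.
have const u v : I u -> I v -> u <= v -> a (slice u x) = a (slice v x).
  move=> Iu Iv uv.
  have sub r : r \in `[u, v] -> I r.
    by rewrite in_itv /= => /andP[ur rv]; apply: I_itv Iu Iv _ _; rewrite ur rv.
  have cont : {within `[u, v], continuous (fun r : R => a (slice r x))}.
    by apply: derivable_within_continuous => r /sub /der [].
  have der0 r : r \in `]u, v[ -> is_derive r 1 (fun r : R => a (slice r x)) (cst 0 r).
    by move=> ruv; apply/der/sub/subset_itv_oo_cc.
  have [r _] := MVT_segment uv der0 cont.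
  by rewrite mul0r => /eqP; rewrite subr_eq0 => /eqP ->.
by case: (leP s t) => [st|/ltW ts]; rewrite -as0; [rewrite -(const s t)|rewrite (const t s)].
Qed.

Variable t0 : R.
Hypothesis I_t0 : I t0.
Hypothesis momentum0 : forall x, U x -> divm (H 0%N t0 c) (dt (H 0%N) t0 c) x = 0.
Hypothesis energy0 : forall x, U x ->
  hamiltonian alpha lambda (H 0%N t0 c) (dt (H 0%N) t0 c) x = 0.

Let G_T := HmT 0.
Let evol := evolution_rep.

Lemma density_vanishes (a : A) : del a = - (half * th) * a ->
  (forall x, U x -> a (slice t0 x) = 0) -> a = 0.
Proof.
move=> da a0; apply: sfun_ext => y Vy; have [It Ux] := Vy.
have q0 : (a * a * \det G : A) y = 0.
  rewrite -(sliceK y); apply: (slice_constant I_t0 It Ux).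
    exact: (conserved_density h2 GK (DD o) da).
  rewrite -[LHS]/(a (slice t0 (rsubmx y)) * a (slice t0 (rsubmx y)) * (\det G : A) _).
  by rewrite a0 // !mul0r.
have /eqP : a y * a y * (\det G : A) y = 0 by exact: q0.
by rewrite !mulf_eq0 (negPf (detG_neq0 Vy)) orbF orbb => /eqP.
Qed.

Lemma momentum_vanishes j : mom j = 0.
Proof.
apply: density_vanishes => [|x Ux].
  exact: (momentum_cons DD dC h2 G_T GK Dal Dl nuE evol).
by have := momentum_rep j I_t0 Ux; rewrite momentum0 // mxE.
Qed.

Lemma energy_vanishes : en = 0.
Proof.
apply: density_vanishes => [|x Ux].
  exact: (energy_cons DD dC h2 G_T GK Dal Dl nuE evol momentum_vanishes).
by have := energy_rep I_t0 Ux; rewrite energy0.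
Qed.

Lemma local_constraints t x : I t -> U x ->
  divm (H 0%N t c) (dt (H 0%N) t c) x = 0 /\
  hamiltonian alpha lambda (H 0%N t c) (dt (H 0%N) t c) x = 0.
Proof.
move=> It Ux; split; last by rewrite energy_rep // energy_vanishes.
by apply/rowP => j; rewrite momentum_rep // momentum_vanishes mxE.
Qed.

Lemma local_einstein y : V y ->
  ricci (cylinder_metric (I := I) alpha (H 0%N) c) y =
  lambda *: cylinder_metric (I := I) alpha (H 0%N) c y.
Proof.
move=> Vy; set g := cylinder_metric _ _ _.
have gE' z : V z -> g z = map_mx (ev z) (cylG G al).
  move=> Vz; rewrite /cylG map_block_mx map_scalar_mx !map_mx0 HmE //.
  by rewrite [(ev z : {rmorphism A -> R}) al]al_eval.
have phiV z : V z -> odom B z by [].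
have dE' (a : A) z i : V z -> partial i (fun y => a y) z = D i a z.
  by move=> Vz; rewrite /D sderE.
rewrite (ricci_rep (odom_open B) phiV dE' gE' (cylG_tr al G_T) (cylGK GK alK)) //.
rewrite (cylRic_einstein DD dC h2 G_T GK alK Dal nuE evol momentum_vanishes energy_vanishes).
by rewrite map_mxZ -gE' // [(ev y : {rmorphism A -> R}) l]l_eval.
Qed.

End LocalSolution.

(** * From one chart to the manifold *)

Lemma posdef_det_neq0 (R : realType) (n : nat) (S : 'M[R]_n) :
  (forall v : 'rV[R]_n, v != 0 -> 0 < (v *m S *m v^T) 0 0) -> \det S != 0.
Proof.
move=> pos; apply/negP => /det0P[v v0 vS].
by have := pos v v0; rewrite vS mul0mx mxE ltxx.
Qed.

Theorem corollary5p8 (R : realType) (n : nat) (hn : (2 <= n)%N)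
    (M : chartedSpace R n) (hM : smooth_manifold M)
    (M_compact : compact [set: M]) (M_connected : connected [set: M])
    (I : set R) (I_open : open I) (I_itv : is_interval I)
    (alpha lambda : R) (alpha_neq0 : alpha != 0)
    (g : R -> tfield M) (g_smooth : smooth_curve I g)
    (g_metric : forall t, I t -> riemannian (g t))
    (evolution : forall t, I t -> forall (c : chart M) x, chart_image c x ->
       dt (dt g) t c x = christoffelm (g t c) (dt g t c) x
                         - (2 * alpha) *: gradm lambda (g t c) x)
    (t0 : R) (I_t0 : I t0)
    (momentum0 : forall (c : chart M) x, chart_image c x ->
       divm (g t0 c) (dt g t0 c) x = 0)
    (energy0 : forall (c : chart M) x, chart_image c x ->
       hamiltonian alpha lambda (g t0 c) (dt g t0 c) x = 0) :
  (forall t, I t -> forall (c : chart M) x, chart_image c x ->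
     divm (g t c) (dt g t c) x = 0 /\
     hamiltonian alpha lambda (g t c) (dt g t c) x = 0) /\
  einstein (cylinder_metric (I := I) alpha g) lambda.
Proof.
have [H [H0 HP]] := g_smooth; subst g.
have [_ _ _ charts _] := hM.
have U_open c : open (chart_image (M := M) c).
  by have [domo _ _ img] := charts c; apply: img.
have det_neq0 (c : chart M) t x : I t -> chart_image c x -> \det (H 0%N t c x) != 0.
  by move=> It Ux; apply: posdef_det_neq0; case: (g_metric t It) => _; apply.
split.
  move=> t It c x Ux.
  (* The point (t0, x) serves as base point of the slab, so the slab is nonempty. *)
  exact: (local_constraints hn I_open I_itv (U_open c) HP
    (det_neq0 c) (fun t x It => @evolution t It c x) (slab_slice I_t0 Ux)
    I_t0 (momentum0 c) (energy0 c) It Ux).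
(* Charts of the cylinder are indexed by those of M, and its chart images consist of slices over
   points of I. *)
move=> c' y [[s x] cx <-]; pose c : chart M := c'.
have Vy : slab I (chart_image c) (slice (set_val s) (chart_map c x)).
  by apply: slab_slice; [exact: set_valP | exists x].
exact: (local_einstein hn alpha_neq0 I_open I_itv (U_open c) HP
  (det_neq0 c) (fun t x It => @evolution t It c x) Vy
  I_t0 (momentum0 c) (energy0 c) Vy).
Qed.
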